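(* Let $(M,\omega)$ be a Kähler manifold with a Hamiltonian action $\tau$ of $S^1$ with moment map $\phi:M\to\mathbb{R}$, and assume that $\tau$ extends to a holomorphic action of $\mathbb{C}^*$ on $M$, also denoted $\tau$. Let $\lambda\in\mathbb{R}$ be such that $S^1$ acts freely on $\phi^{-1}(\lambda)$. Let $M^\lambda$ be the (Kähler) cut of $M$ at $\lambda$, let $M^\lambda_o=\{p\in M\mid \phi(p)<\lambda\}$, regarded both as an open subset of $M$ and as an open subset of $M^\lambda$, and let $M_{\mathrm{stable}}=\mathbb{C}^*\cdot\phi^{-1}(\lambda)$ and $M^\#=M^\lambda_o\cup M_{\mathrm{stable}}$. Let $v=\nabla\phi$ be the gradient vector field of $\phi$ and define $g(q)=\exp(\kappa(q)v)(q)$ for $q\in M^\lambda_o$, where $\kappa(q)=-\tfrac12\log(\lambda-\phi(q))$. Then the map $g:M^\lambda_o\to M^\#$ is a biholomorphism of $M^\lambda_o$ with its $M^\lambda$ complex structure onto the open subset $M^\#$ of $M$ with its $M$ complex structure.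
   Context: Conventions: a moment map $\phi$ for a circle action with infinitesimal generator $\xi$ (of $\theta\mapsto\tau_{e^{i\theta}}$) satisfies $\iota_\xi\omega=-d\phi$; then the gradient $v=\nabla\phi$ with respect to the Kähler metric is the infinitesimal generator of the one-parameter group $t\mapsto \tau_{e^t}$, so $\exp(tv)=\tau_{e^t}$. Cut: equip $M\times\mathbb{C}$ with the Kähler form $\omega+\sqrt{-1}\,dz\wedge d\bar z$ and the diagonal $S^1$-action $e^{i\theta}\cdot(p,z)=(\tau_{e^{i\theta}}p,e^{i\theta}z)$, which has moment map $\psi(p,z)=\phi(p)+|z|^2$. $S^1$ acts freely on $\psi^{-1}(\lambda)$, and the cut is the Kähler quotient $M^\lambda=\psi^{-1}(\lambda)/S^1$ with its reduced Kähler structure $(\omega^\lambda,J^\lambda)$. It is the disjoint union of $\phi^{-1}(\lambda)/S^1$ (the image of the points $(p,0)$ with $\phi(p)=\lambda$) and of an open subset which is identified with $M^\lambda_o$ by the map $p\mapsto [(p,\sqrt{\lambda-\phi(p)})]$. The ''$M^\lambda$ complex structure'' on $M^\lambda_o$ is the one obtained from $M^\lambda$ by this identification; the ''$M$ complex structure'' on an open subset of $M$ is the restriction of the complex structure of $M$. *)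

(* Defs.v *)
From mathcomp Require Import all_boot all_order all_algebra.
From mathcomp Require Import all_classical all_reals all_analysis.
From mathcomp Require Import complex.

Set Implicit Arguments.
Unset Strict Implicit.
Unset Printing Implicit Defensive.

Import Order.TTheory GRing.Theory Num.Theory.
Import numFieldNormedType.Exports.

Local Open Scope classical_set_scope.
Local Open Scope ring_scope.

(** * Model spaces *)

(* A model space is a real normed space with a complex structure; complex
   vector spaces are treated as real ones so that real calculus (moment maps,
   symplectic forms, gradients) and holomorphy share one derivative ['d]. *)
Record cspace (R : realType) := CSpace {
  csort :> normedModType R;
  cJ : csort -> csort }.
Arguments cJ {R c}.

(* C^n as R^n x R^n, the pair (x, y) standing for x + i y. *)
Definition Cn (R : realType) (n : nat) : cspace R :=
  @CSpace R ('rV[R]_n * 'rV[R]_n)%type (fun u => (- u.2, u.1)).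

Definition C1 (R : realType) : cspace R :=
  @CSpace R (R * R)%type (fun u => (- u.2, u.1)).

Definition cprod (R : realType) (E F : cspace R) : cspace R :=
  @CSpace R (E * F)%type (fun u => (cJ u.1, cJ u.2)).

Definition cdifferentiable (R : realType) (E F : cspace R) (f : E -> F)
    (x : E) : Prop :=
  differentiable f x /\ forall u : E, 'd f x (cJ u) = cJ ('d f x u).

Fixpoint Ck (R : realType) (V W : normedModType R) (k : nat) (f : V -> W)
    (U : set V) : Prop :=
  if k is k'.+1 then
    (forall x, U x -> differentiable f x) /\
    forall v : V, Ck k' (fun x => 'd f x v) U
  else forall x, U x -> {for x, continuous f}.

(* C^oo on an open subset of a finite-dimensional space. *)
Definition smooth (R : realType) (V W : normedModType R) (f : V -> W)
    (U : set V) : Prop := forall k : nat, Ck k f U.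

(** * Complex manifolds *)

(* The atlas is indexed by the points: [chart p] is a chart around [p], with
   domain [dom p] and inverse [param p].  The tangent space at [p] is the
   model space, a vector being given by its coordinates in [chart p]; as the
   transition maps are holomorphic, the complex structure J of the tangent
   space is [cJ] in these coordinates. *)
Record charted (R : realType) (E : cspace R) := Charted {
  point_of :> topologicalType;
  dom : point_of -> set point_of;
  chart : point_of -> point_of -> E;
  param : point_of -> E -> point_of }.
Arguments dom {R E c}.
Arguments chart {R E c}.
Arguments param {R E c}.

Definition complex_manifold (R : realType) (E : cspace R) (M : charted E) :
    Prop :=
  [/\ hausdorff_space M,
      @second_countable M,
      forall p : M, [/\ open (dom p) /\ dom p p, open (chart p @` dom p),
        (forall q, dom p q -> param p (chart p q) = q),
        (forall q, dom p q -> {for q, continuous (chart p)}) &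
        (forall x, (chart p @` dom p) x -> {for x, continuous (param p)})] &
      forall p q : M, forall x, (chart p @` (dom p `&` dom q)) x ->
        cdifferentiable (chart q \o param p) x].

Section Maps.
Context (R : realType) (E F : cspace R) (X : charted E) (Y : charted F).

Definition in_charts (f : X -> Y) (a : X) (b : Y) : E -> F :=
  chart b \o f \o param a.

Definition tangent (f : X -> Y) (x : X) : E -> F :=
  fun u => 'd (in_charts f x (f x)) (chart x x) u.

Definition holomorphic_on (f : X -> Y) (U : set X) : Prop :=
  forall x, U x -> {for x, continuous f} /\
    cdifferentiable (in_charts f x (f x)) (chart x x).

Definition smooth_on (f : X -> Y) (U : set X) : Prop :=
  (forall x, U x -> {for x, continuous f}) /\
  forall (a : X) (b : Y),
    smooth (in_charts f a b) (chart a @` (dom a `&` U `&` f @^-1` dom b)).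

End Maps.

(* The inverse is quantified universally, and not existentially, because
   there is no function [Y -> X] when X is empty and Y is not. *)
Definition biholomorphism_onto (R : realType) (E F : cspace R)
    (X : charted E) (Y : charted F) (f : X -> Y) (V : set Y) : Prop :=
  [/\ open V, set_bij [set: X] V f, holomorphic_on f [set: X] &
      forall h : Y -> X, cancel f h -> holomorphic_on h V].

Section Real_functions.
Context (R : realType) (E : cspace R) (X : charted E).

Definition differential (f : X -> R) (x : X) (u : E) : R :=
  'd (f \o param x) (chart x x) u.

Definition smooth_fun (f : X -> R) : Prop :=
  forall a : X, smooth (f \o param a : E -> R) (chart a @` dom a).

End Real_functions.

Definition C1_charted (R : realType) : charted (C1 R) :=
  @Charted R (C1 R) (R * R)%type (fun _ => setT) (fun _ z => z) (fun _ z => z).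

Definition prod_charted (R : realType) (E F : cspace R)
    (X : charted E) (Y : charted F) : charted (cprod E F) :=
  @Charted R (cprod E F) (X * Y)%type
    (fun p => dom p.1 `*` dom p.2)
    (fun p q => (chart p.1 q.1, chart p.2 q.2))
    (fun p u => (param p.1 u.1, param p.2 u.2)).

(* The structure on S transported from Q by an injection [j : S -> Q] with
   open image, i.e. by an identification of S with an open subset of Q. *)
Definition transported (R : realType) (E : cspace R) (S : choiceType)
    (Q : charted E) (j : S -> Q) : charted E :=
  @Charted R E (initial_topology j)
    (fun p => j @^-1` dom (j p))
    (fun p q => chart (j p) (j q))
    (fun p u => xget p [set q | j q = param (j p) u]).

(** * Kähler forms *)

Definition form2 (R : realType) (E : cspace R) (X : charted E) :=
  X -> E -> E -> R.

Section Kahler.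
Context (R : realType) (E : cspace R) (X : charted E) (w : form2 X).

(* Coefficients of the form w in [chart a], as a function on the model
   space. *)
Definition form_in_chart (a : X) (u v : E) (x : E) : R :=
  let q := param a x in
  w q ('d (chart q \o param a) x u) ('d (chart q \o param a) x v).

Definition smooth_form : Prop :=
  forall (a : X) (u v : E), smooth (form_in_chart a u v) (chart a @` dom a).

Definition closed_form : Prop :=
  forall (a : X) (u v t : E) (x : E), (chart a @` dom a) x ->
    'd (form_in_chart a v t) x u + 'd (form_in_chart a t u) x v
      + 'd (form_in_chart a u v) x t = 0.

(* The Riemannian metric of a Kähler form, w(u, J v). *)
Definition metric (p : X) (u v : E) : R := w p u (cJ v).

Definition kahler_form : Prop :=
  [/\ (forall p c u v t, w p u (c *: v + t) = c * w p u v + w p u t) /\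
      (forall p u v, w p u v = - w p v u),
      smooth_form,
      closed_form,
      (forall p u v, w p (cJ u) (cJ v) = w p u v) &
      (forall p u, u != 0 -> 0 < metric p u u)].

(* The gradient of f; the defining condition has exactly one solution when w
   is a Kähler form on a finite-dimensional manifold. *)
Definition gradient (f : X -> R) (p : X) : E :=
  xget 0 [set v | forall u, metric p v u = differential f p u].

End Kahler.

(** * Flows *)

Definition integral_curve (R : realType) (E : cspace R) (X : charted E)
    (v : X -> E) (c : R -> X) : Prop :=
  continuous c /\
  forall s : R, is_derive s 1 (fun r => chart (c s) (c r) : E) (v (c s)).

(* exp(t v)(q), for a complete vector field v. *)
Definition exp_field (R : realType) (E : cspace R) (X : charted E)
    (v : X -> E) (t : R) (q : X) : X :=
  xget q [set r | exists c, [/\ integral_curve v c, c 0 = q & c t = r]].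

(** * Circle actions and moment maps *)

Definition expi (R : realType) (t : R) : R[i] := Complex (cos t) (sin t).

Definition to_C (R : realType) (z : R * R) : R[i] := Complex z.1 z.2.

Definition of_C (R : realType) (z : R[i]) : R * R := (complex.Re z, complex.Im z).

Section Actions.
Context (R : realType) (E : cspace R) (X : charted E).

(* Values of [tau] at 0 are irrelevant. *)
Definition holomorphic_Cstar_action (tau : R[i] -> X -> X) : Prop :=
  [/\ forall p, tau 1 p = p,
      forall a b p, a != 0 -> b != 0 -> tau (a * b) p = tau a (tau b p) &
      @holomorphic_on R _ _ (prod_charted (C1_charted R) X) X
        (fun zp => tau (to_C zp.1) zp.2) [set zp | to_C zp.1 != 0]].

Definition generator (tau : R[i] -> X -> X) (p : X) : E :=
  derive1 (fun t : R => chart p (tau (expi t) p) : E) 0.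

(* The action of the circle |a| = 1 given by [tau] preserves w and phi is a
   moment map for it. *)
Definition hamiltonian (w : form2 X) (tau : R[i] -> X -> X) (phi : X -> R) :
    Prop :=
  [/\ forall a p u v, `|a| = 1 ->
        w (tau a p) (tangent (tau a) p u) (tangent (tau a) p v) = w p u v,
      smooth_fun phi &
      forall p u, w p (generator tau p) u = - differential phi p u].

Definition free_on (tau : R[i] -> X -> X) (Z : set X) : Prop :=
  forall p a, Z p -> `|a| = 1 -> tau a p = p -> a = 1.

End Actions.

(** * Kähler quotients *)

Section Quotient.
Context (R : realType) (E F : cspace R) (X : charted E) (Q : charted F).
Context (w : form2 X) (tau : R[i] -> X -> X) (psi : X -> R) (lam : R).

Definition level : set X := [set x | psi x = lam].

Definition level_tangent (x : X) : set E :=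
  [set u | differential psi x u = 0].

(* The orthogonal complement of the orbit direction in the tangent space of
   the level set. *)
Definition horizontal (x : X) : set E :=
  [set u | level_tangent x u /\ metric w x u (generator tau x) = 0].

(* (Q, wQ), with projection [pi], is the Kähler quotient of the level set by
   the circle: as a space Q is the set of orbits with the quotient topology;
   [pi] is a smooth submersion; its restriction to horizontal vectors is
   complex linear; and the pullback of wQ is the restriction of w.  A map on
   the level set is smooth when it extends locally to a smooth map on X; its
   differential along the level set does not depend on the extension [f]. *)
Definition kahler_quotient (wQ : form2 Q) (pi : level -> Q) : Prop :=
  [/\ complex_manifold Q /\ kahler_form wQ,
      (forall y : Q, exists x, pi x = y),
      (forall x y : level,
         pi x = pi y <-> exists2 a : R[i], `|a| = 1 & val y = tau a (val x)),
      (forall A : set Q, open A <->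
         exists2 U : set X, open U &
           forall x : level, A (pi x) <-> U (val x)) &
      forall x : level, exists (f : X -> Q) (U : set X),
        [/\ open U /\ U (val x),
            smooth_on f U /\ (forall y : level, U (val y) -> f (val y) = pi y),
            (forall e : F,
               exists2 u, level_tangent (val x) u & tangent f (val x) u = e),
            (forall u, horizontal (val x) u ->
               tangent f (val x) (cJ u) = cJ (tangent f (val x) u)) &
            (forall u v, level_tangent (val x) u -> level_tangent (val x) v ->
               wQ (pi x) (tangent f (val x) u) (tangent f (val x) v)
                 = w (val x) u v)]].

End Quotient.

(** * The cut *)

Section Cut.
Context (R : realType) (E : cspace R) (M : charted E).
Context (w : form2 M) (tau : R[i] -> M -> M) (phi : M -> R) (lam : R).

Definition MxC : charted (cprod E (C1 R)) := prod_charted M (C1_charted R).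

(* w + i dz /\ dzbar, where i dz /\ dzbar = 2 dx /\ dy. *)
Definition cut_form : form2 MxC :=
  fun p u v => w p.1 u.1 v.1 + 2 * (u.2.1 * v.2.2 - u.2.2 * v.2.1).

Definition cut_action (a : R[i]) (p : MxC) : MxC :=
  (tau a p.1, of_C (a * to_C p.2)).

Definition cut_moment (p : MxC) : R := phi p.1 + (p.2.1 ^+ 2 + p.2.2 ^+ 2).

Definition kahler_cut (Q : charted E) (wQ : form2 Q)
    (pi : level cut_moment lam -> Q) : Prop :=
  kahler_quotient cut_form cut_action wQ pi.

Definition M_below : set M := [set p | phi p < lam].

Definition M_stable : set M :=
  [set q | exists a p, [/\ a != 0, phi p = lam & q = tau a p]].

Definition M_sharp : set M := M_below `|` M_stable.

Lemma cut_section_subproof (q : M_below) :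
  ((val q, (Num.sqrt (lam - phi (val q)), 0)) : MxC)
    \in level cut_moment lam.
Proof.
apply/mem_set; rewrite /level /cut_moment /=.
have /set_mem /= hq := valP q.
by rewrite sqr_sqrtr ?subr_ge0 1?ltW// expr0n/= addr0 addrC subrK.
Qed.

Definition cut_section (q : M_below) : level cut_moment lam :=
  exist (fun x => x \in level cut_moment lam) _ (cut_section_subproof q).

(* M_below with its "M^lambda complex structure". *)
Definition M_below_cut (Q : charted E) (pi : level cut_moment lam -> Q) :
    charted E := transported (pi \o cut_section).

Definition kappa (q : M) : R := - 2^-1 * ln (lam - phi q).

Definition cut_map (q : M_below) : M :=
  exp_field (gradient w phi) (kappa (val q)) (val q).

End Cut.

(* Main.v *)
(* Let sigma_s = tau_{e^s}.  As tau is holomorphic, its generator speed = -J xi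
   is grad phi, so sigma is the gradient flow, and for each r the function
   height_r(s) = phi(sigma_s r) + e^{2s} is strictly increasing.  The points r
   for which it takes the value lam, at a unique time s(r), form M^#; on them
   r |-> sigma_{s(r)} r inverts g, since kappa(q) = -s(g(q)).

   Thus stable_section r = (sigma_{s(r)} r, e^{s(r)}) is a point of the level
   set of psi, and g^{-1} is its class in the cut.  The function s is
   differentiable by the implicit function theorem.  The section itself is not
   holomorphic, but subtracting from its differential the component along the
   circle orbit gives a horizontal vector, which agrees modulo the orbit
   direction with a complex linear lift; as the projection to the quotient is
   complex linear on horizontal vectors, so is the differential of g^{-1}, and
   it is injective because the reduced form is nondegenerate.  Finally g is
   continuous for the quotient topology, so it is differentiable, being a
   continuous inverse. *)
From HB Require Import structures.
Require Import Defs.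
From mathcomp Require Import all_boot all_order all_algebra.
From mathcomp Require Import all_classical all_reals all_analysis.
From mathcomp Require Import complex ring lra.
Import numFieldNormedType.Exports.
Local Open Scope classical_set_scope.
Local Open Scope ring_scope.

Set Implicit Arguments.
Unset Strict Implicit.
Unset Printing Implicit Defensive.
Import Order.TTheory GRing.Theory Num.Theory.

(** * Differential calculus *)

Section Differentials.
Context (R : realType).
Implicit Types V W Z : normedModType R.

Lemma is_diff_linear V W (f df : V -> W) x : is_diff x f df -> linear df.
Proof. by move=> [_ <-] a u v; rewrite linearP. Qed.

Lemma is_diff_continuous V W (f df : V -> W) x : is_diff x f df -> continuous df.
Proof. by move=> [fx <-]; exact: diff_continuous. Qed.

Definition linear_pack V W (f : V -> W) (lf : linear f) : {linear V -> W} :=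
  HB.pack f (GRing.isLinear.Build _ _ _ _ f lf).

Lemma lin0 V W (f : V -> W) : linear f -> f 0 = 0.
Proof. by move=> lf; exact: (linear0 (linear_pack lf)). Qed.

Lemma linZ V W (f : V -> W) a u : linear f -> f (a *: u) = a *: f u.
Proof. by move=> lf; rewrite -[f]/(linear_pack lf : _ -> _) linearZ. Qed.

Lemma linD V W (f : V -> W) u v : linear f -> f (u + v) = f u + f v.
Proof. by move=> lf; exact: (linearD (linear_pack lf)). Qed.

Lemma linN V W (f : V -> W) u : linear f -> f (- u) = - f u.
Proof. by move=> lf; exact: (linearN (linear_pack lf)). Qed.

Lemma cJ0 n : cJ 0 = 0 :> Cn R n.
Proof. by rewrite /= oppr0. Qed.

Lemma cJK n (u : Cn R n) : cJ (cJ u) = - u.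
Proof. by case: u. Qed.

Lemma is_diffP V W (f df : V -> W) (x : V) : is_diff x f df <->
  [/\ linear df, continuous df & forall e : R, 0 < e ->
    \forall h \near (0 : V), `|f (h + x) - f x - df h| <= e * `|h|].
Proof.
split=> [fdf|[ldf cdf fdf]].
  split; [exact: is_diff_linear fdf|exact: is_diff_continuous fdf|].
  have [dfx dfE] := fdf; have [_] := (diff_locallyP x f).1 dfx.
  rewrite dfE => /eqaddoP fo e e0.
  apply: filterS (fo e e0) => h /=.
  by rewrite opprD addrA.
have fo : f \o shift x = cst (f x) + linear_pack ldf +o_ 0 id.
  apply/eqaddoP => e e0; apply: filterS (fdf e e0) => h /=.
  by rewrite /= opprD addrA.
have dE := diff_unique (df := linear_pack ldf) cdf fo.
apply: DiffDef; last exact: dE.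
by apply/diff_locallyP; rewrite dE.
Qed.

Lemma near_translate V (P : set V) (x : V) :
  (\forall y \near x, P y) -> \forall h \near (0 : V), P (h + x).
Proof. by rewrite (near_shift 0 x P) subr0. Qed.

Lemma is_diff_near V W (f g df : V -> W) (x : V) :
  (\forall y \near x, f y = g y) -> is_diff x f df -> is_diff x g df.
Proof.
move=> fg /is_diffP[ldf cdf fdf]; apply/is_diffP; split=> // e e0.
have fg0 : \forall h \near (0 : V), f (h + x) = g (h + x).
  exact: near_translate fg.
near=> h.
rewrite -(near fg0 h)// -(nbhs_singleton fg).
by near: h; exact: fdf.
Unshelve. all: by end_near. Qed.

Lemma is_diff_lin V W (f : V -> W) x : linear f -> continuous f -> is_diff x f f.
Proof.
move=> lf cf; apply: DiffDef; first exact: (linear_differentiable (f := linear_pack lf)).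
exact: (diff_lin (f := linear_pack lf)).
Qed.

Lemma linear_bound V W (f : V -> W) : linear f -> continuous f ->
  exists2 k : R, 0 < k & forall x, `|f x| <= k * `|x|.
Proof. by move=> lf cf; exact: (@linear_lipschitz _ _ _ (linear_pack lf)). Qed.

(* With [Phi (x, y) = f y - x] this is the differentiability of a continuous
   local inverse [y] of [f]. *)
Lemma implicit_is_diff V W Z (Phi dPhi : V * W -> Z) (y : V -> W) (x : V)
    (A : Z -> W) :
  is_diff (x, y x) Phi dPhi -> {for x, continuous y} ->
  (\forall x' \near x, Phi (x', y x') = Phi (x, y x)) ->
  linear A -> continuous A -> (forall k, A (dPhi (0, k)) = k) ->
  is_diff x y (fun h => - A (dPhi (h, 0))).
Proof.
move=> dP cy Pc lA cA AK; have /is_diffP[ldP cdP oP] := dP.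
have [C C0 AC] := linear_bound lA cA.
have [D D0 PD] := linear_bound ldP cdP.
have cE : continuous (fun h : V => - A (dPhi (h, 0))).
  move=> h; apply: cvgN; apply: (@continuous_comp _ _ _ (fun h => dPhi (h, 0)) A); last exact: cA.
  apply: (@continuous_comp _ _ _ (fun h : V => (h, 0 : W)) dPhi); last exact: cdP.
  by apply: cvg_pair; [exact: cvg_id|exact: cvg_cst].
have lE : linear (fun h : V => - A (dPhi (h, 0))).
  move=> a u v /=.
  rewrite (_ : (a *: u + v, 0) = a *: (u, 0 : W) + (v, 0 : W)); last first.
    by congr (_, _); rewrite /= ?scaler0 ?addr0.
  by rewrite ldP lA opprD scalerN.
apply/is_diffP; split=> // e e0.
have [B B0 EB] := linear_bound lE cE.
(* The first bound on [eta] lets half of [|k|] be absorbed in [kh]; the second makes the final error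
   at most [e * |h|]. *)
pose eta := Num.min ((2 * C)^-1) (e / (C * (2 * B + 2))).
have eta0 : 0 < eta.
  by rewrite lt_min invr_gt0 divr_gt0 ?mulr_gt0// addr_gt0// mulr_gt0.
have Ceta : C * eta <= 2^-1.
  by rewrite -ler_pdivlMl// -invfM mulrC ge_min mulrC lexx.
have Ceta2 : C * eta * (2 * B + 2) <= e.
  rewrite -mulrA [eta * _]mulrC mulrA -ler_pdivlMl ?mulr_gt0 ?addr_gt0 ?mulr_gt0//.
  by rewrite mulrC ge_min lexx orbT.
have k0' : (fun h : V => y (h + x) - y x) @ 0 --> (0 : W).
  rewrite -(subrr (y x)); apply: cvgB; last exact: cvg_cst.
  by rewrite (cvg_comp_shift x 0 y) add0r.
have k0 : (fun h : V => (h, y (h + x) - y x)) @ 0 --> (0 : V * W).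
  by apply: cvg_pair; [exact: cvg_id|exact: k0'].
have {}Pc : \forall h \near (0 : V), Phi (h + x, y (h + x)) = Phi (x, y x).
  exact: near_translate Pc.
near=> h.
have : `|Phi ((h, y (h + x) - y x) + (x, y x)) - Phi (x, y x)
    - dPhi (h, y (h + x) - y x)| <= eta * `|(h, y (h + x) - y x)|.
  by near: h; exact: (k0 _ (oP _ eta0)).
set k := y (h + x) - y x.
have -> : (h, k) + (x, y x) = (h + x, y (h + x)).
  by congr (_, _); rewrite /= /k subrK.
rewrite (near Pc h)// subrr sub0r normrN => hk.
(* As [A] is a left inverse of the partial differential in the second variable, [A (dPhi (h, k))] is
   exactly the error of the candidate differential of [y]. *)
have hkE : A (dPhi (h, k)) = k + A (dPhi (h, 0)).
  have -> : (h, k) = 1 *: (0, k) + (h, 0).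
    by congr (_, _); rewrite /= ?scaler0 ?scale1r ?add0r ?addr0.
  by rewrite ldP lA AK scale1r.
have hkn : `|(h, k)| <= `|h| + `|k|.
  by rewrite prod_normE /= ge_max lerDl lerDr !normr_ge0.
have main : `|k + A (dPhi (h, 0))| <= C * eta * (`|h| + `|k|).
  rewrite -hkE (le_trans (AC _))// -mulrA ler_wpM2l ?(ltW C0)//.
  by rewrite (le_trans hk)// ler_wpM2l// ltW.
(* An a priori linear bound on the increment of [y], which turns an error in [|h| + |k|] into one in
   [|h|]. *)
have kh : `|k| <= (2 * B + 1) * `|h|.
  have : `|k| <= B * `|h| + 2^-1 * (`|h| + `|k|).
    rewrite -{1}(addrK (A (dPhi (h, 0))) k).
    rewrite (le_trans (ler_normD _ _))// [leRHS]addrC lerD//.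
    by rewrite (le_trans main)// ler_wpM2r// addr_ge0.
  lra.
rewrite opprK -/k (le_trans main)//.
apply: (@le_trans _ _ (C * eta * ((2 * B + 2) * `|h|))).
  rewrite ler_wpM2l//; last lra.
  by rewrite mulr_ge0// ltW.
by rewrite mulrA ler_wpM2r.
Unshelve. all: by end_near. Qed.

(** Such a map is a finite sum of coordinates times the images of the basis vectors. *)
Lemma rV_linear_continuous n W (f : 'rV[R]_n -> W) : linear f -> continuous f.
Proof.
move=> lf.
have fE u : f u = \sum_(i < n) u 0 i *: f (delta_mx 0 i).
  rewrite {1}(row_sum_delta u) -[f]/(linear_pack lf : _ -> _) linear_sum.
  by apply: eq_bigr => i _; rewrite linearZ.
rewrite (_ : f = fun u => \sum_(i < n) u 0 i *: f (delta_mx 0 i)); last exact/funext.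
have -> : (fun u : 'rV[R]_n => \sum_(i < n) u 0 i *: f (delta_mx 0 i)) =
    \sum_(i < n) (fun u : 'rV[R]_n => u 0 i *: f (delta_mx 0 i)).
  by apply/funext => u; rewrite fct_sumE.
have cc (i : 'I_n) : continuous (fun v : 'rV[R]_n => v 0 i *: f (delta_mx 0 i)).
  by move=> u; apply: (@cvgZr_tmp _ _ _ (nbhs u) _ _ (u 0 i));
    exact: (@coord_continuous R 1 n 0 i u).
apply: (big_ind (fun g : _ -> W => continuous g)) => [|g h cg ch|i _].
- exact: cst_continuous.
- by move=> u; apply: continuousD; [exact: cg|exact: ch].
- exact: cc.
Qed.

Lemma Cn_linear_continuous n W (f : 'rV[R]_n * 'rV[R]_n -> W) : linear f -> continuous f.
Proof.
move=> lf.
have c1 : continuous (fun x => f (x, 0)).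
  apply: rV_linear_continuous => a u v.
  by rewrite -lf; congr f; congr (_, _); rewrite /= ?scaler0 ?addr0.
have c2 : continuous (fun x => f (0, x)).
  apply: rV_linear_continuous => a u v.
  by rewrite -lf; congr f; congr (_, _); rewrite /= ?scaler0 ?addr0.
have -> : f = ((fun x : 'rV[R]_n => f (x, 0)) \o @fst 'rV[R]_n 'rV[R]_n)
    + ((fun x : 'rV[R]_n => f (0, x)) \o @snd 'rV[R]_n 'rV[R]_n).
  apply/funext => -[x y].
  have xyE : (x, y) = 1 *: (x, 0) + (0, y).
    by congr (_, _); rewrite /= ?scaler0 ?scale1r ?addr0 ?add0r.
  by rewrite {1}xyE lf scale1r.
move=> u; apply: continuousD.
  apply: (@continuous_comp _ _ _ (@fst 'rV[R]_n 'rV[R]_n)). exact: cvg_fst. exact: c1.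
apply: (@continuous_comp _ _ _ (@snd 'rV[R]_n 'rV[R]_n)). exact: cvg_snd. exact: c2.
Qed.

End Differentials.

(** * Maps between charted spaces *)

Section Charted.
Context (R : realType).
Implicit Types E F G : cspace R.

(** The chart clause of [complex_manifold] on its own, so that it applies equally to vector spaces
    and to products. *)
Definition atlas E (X : charted E) : Prop :=
  forall p : X, [/\ open (dom p) /\ dom p p, open (chart p @` dom p),
    (forall q, dom p q -> param p (chart p q) = q),
    (forall q, dom p q -> {for q, continuous (chart p)}) &
    (forall x, (chart p @` dom p) x -> {for x, continuous (param p)})].

Definition vec E : charted E :=
  @Charted R E E (fun _ => setT) (fun _ z => z) (fun _ z => z).

(* The complex structure of a [cspace] is irrelevant here, whence the dummy [id]. *)
Definition line : charted (@CSpace R R id) := vec (@CSpace R R id).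

Lemma atlas_vec E : atlas (vec E).
Proof.
move=> p; split=> [|||q _|x _]; last by exact: cvg_id.
- by split=> //; exact: openT.
- rewrite (_ : chart p @` dom p = setT); first exact: openT.
  by apply/seteqP; split=> // x _; exists x.
- by [].
- exact: cvg_id.
Qed.

Lemma atlas_C1 : atlas (C1_charted R).
Proof. exact: (@atlas_vec (C1 R)). Qed.

(* [L] is the tangent map of [f] at [x].  Since the tangent space at a point is
   read in the chart centred at that point, the chain rule involves no
   transition maps. *)
Definition mdiff E F (X : charted E) (Y : charted F) (f : X -> Y) (x : X)
    (L : E -> F) : Prop :=
  {for x, continuous f} /\ is_diff (chart x x) (in_charts f x (f x)) L.

Section Basics.
Context E F (X : charted E) (Y : charted F) (aX : atlas X).
Implicit Types (f g : X -> Y) (x : X) (L : E -> F).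

Lemma param_chart (x y : X) : dom x y -> param x (chart x y) = y.
Proof. by have [_ _ + _ _] := aX x; apply. Qed.

Lemma dom_center (x : X) : dom x x.
Proof. by have [[]] := aX x. Qed.

Lemma near_dom (x : X) : \forall y \near x, dom x y.
Proof. by have [[oU xU] _ _ _ _] := aX x; exact: open_nbhs_nbhs. Qed.

Lemma param_continuous (x y : X) : dom x y -> {for chart x y, continuous (param x)}.
Proof. by move=> xy; have [_ _ _ _] := aX x; apply; exists y. Qed.

Lemma chart_continuous (x y : X) : dom x y -> {for y, continuous (chart x)}.
Proof. by move=> xy; have [_ _ _ + _] := aX x; apply. Qed.

Lemma near_param (x y : X) (P : set X) : dom x y ->
  (\forall z \near y, P z) -> \forall u \near chart x y, P (param x u).
Proof.
move=> xy yP; apply: (param_continuous xy).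
by rewrite param_chart.
Qed.

Lemma chart_param (x y : X) : dom x y ->
  \forall u \near chart x y, dom x (param x u) /\ chart x (param x u) = u.
Proof.
move=> xy; have [_ oI _ _ _] := aX x.
have : \forall u \near chart x y, (chart x @` dom x) u.
  by apply: open_nbhs_nbhs; split=> //; exists y.
by apply: filterS => _ [z xz <-]; rewrite param_chart.
Qed.

Lemma mdiff_tangent f x L : mdiff f x L -> tangent f x = L.
Proof. by move=> [_ [_ dfE]]; apply/funext => u; rewrite /tangent dfE. Qed.

(** Identities between tangent maps are obtained below by differentiating one map in two ways. *)
Lemma mdiff_unique f x L L' : mdiff f x L -> mdiff f x L' -> L = L'.
Proof. by move=> /mdiff_tangent <- /mdiff_tangent. Qed.

Lemma mdiff_linear f x L : mdiff f x L -> linear L.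
Proof. by case=> _ /is_diff_linear. Qed.

Lemma mdiff_near f g x L : (\forall y \near x, f y = g y) ->
  mdiff f x L -> mdiff g x L.
Proof.
move=> fg [cf df]; have fgx := nbhs_singleton fg; split.
  move=> A; rewrite -fgx => /cf fA; rewrite !near_simpl in fA *.
  by apply: filterS2 fg fA => y ->.
apply: is_diff_near df.
have := near_param (dom_center x) fg; rewrite fgx.
by apply: filterS => u; rewrite /in_charts /= => ->.
Qed.

End Basics.

(** Both coordinate expressions use the chart centred at [f x], where [param] cancels [chart]
    nearby, so the composite of the expressions is that of the composite near the centre. *)
Lemma mdiff_comp E F G (X : charted E) (Y : charted F) (Z : charted G)
    (f : X -> Y) (g : Y -> Z) x L L' : atlas X -> atlas Y ->
  mdiff f x L -> mdiff g (f x) L' -> mdiff (g \o f) x (L' \o L).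
Proof.
move=> aX aY [cf df] [cg dg]; split; first exact: continuous_comp.
have fxE : in_charts f x (f x) (chart x x) = chart (f x) (f x).
  by rewrite /in_charts /= param_chart//; exact: dom_center.
rewrite -fxE in dg.
apply: is_diff_near (is_diff_comp df dg).
have := near_param aX (dom_center aX x) (cf _ (near_dom aY (f x))).
by apply: filterS => u xu; rewrite /in_charts /= param_chart.
Qed.

Lemma mdiff_id E (X : charted E) (x : X) : atlas X -> mdiff (@id X) x id.
Proof.
move=> aX; split; first exact: cvg_id.
apply: is_diff_near (is_diff_id _).
by apply: filterS (chart_param aX (dom_center aX x)) => u [_ uE]; rewrite /in_charts /= uE.
Qed.

Lemma mdiff_cst E F (X : charted E) (Y : charted F) (x : X) (y : Y) :
  mdiff (fun _ : X => y) x (fun _ => 0).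
Proof. by split; [exact: cvg_cst|exact: is_diff_cst]. Qed.

Lemma mdiff_pair E F G (X : charted E) (Y : charted F) (Z : charted G)
    (f : X -> Y) (g : X -> Z) x L L' :
  mdiff f x L -> mdiff g x L' ->
  @mdiff _ _ X (prod_charted Y Z) (fun y => (f y, g y)) x (fun u => (L u, L' u)).
Proof.
move=> [cf df] [cg dg]; split; first exact: cvg_pair.
exact: (is_diff_pair df dg).
Qed.

Lemma open_setX (S T : topologicalType) (A : set S) (B : set T) :
  open A -> open B -> open (A `*` B).
Proof.
rewrite !openE => oA oB [x y] [/= Ax By].
by exists (A, B) => //; split; [exact: oA|exact: oB].
Qed.

Lemma continuous_pair_map (S T S' T' : topologicalType) (f : S -> S')
    (g : T -> T') (p : S * T) :
  {for p.1, continuous f} -> {for p.2, continuous g} ->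
  {for p, continuous (fun u : S * T => (f u.1, g u.2))}.
Proof.
move=> cf cg; apply: (@cvg_pair _ _ _ (nbhs p) (nbhs (f p.1)) (nbhs (g p.2))).
  by apply: (@continuous_comp _ _ _ fst f p); [exact: cvg_fst|exact: cf].
by apply: (@continuous_comp _ _ _ snd g p); [exact: cvg_snd|exact: cg].
Qed.

Lemma atlas_prod E F (X : charted E) (Y : charted F) :
  atlas X -> atlas Y -> atlas (prod_charted X Y).
Proof.
move=> aX aY [p q]; have [[oX pX] oX' kX cX pcX] := aX p.
have [[oY qY] oY' kY cY pcY] := aY q; split.
- by split=> //; exact: open_setX.
- rewrite (_ : _ @` _ = (chart p @` dom p) `*` (chart q @` dom q)).
    exact: open_setX.
  apply/seteqP; split=> [_ [[x y] [/= px qy] <-]|[_ _] [/= [x px <-] [y qy <-]]].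
    by split; [exists x|exists y].
  by exists (x, y).
- by move=> [p' q'] [/= h1 h2]; congr (_, _); [exact: kX|exact: kY].
- move=> [p1 q1] [/= h1 h2]; exact: (@continuous_pair_map _ _ _ _ _ _ (p1, q1) (cX _ h1) (cY _ h2)).
- move=> _ [[p' q'] [/= h1 h2] <-]; apply: continuous_pair_map.
    by apply: pcX; exists p'.
  by apply: pcY; exists q'.
Qed.

Lemma mdiff_fst E F (X : charted E) (Y : charted F) (p : prod_charted X Y) :
  atlas X -> @mdiff _ _ (prod_charted X Y) X fst p fst.
Proof.
move=> aX; split; first exact: cvg_fst.
have fd : is_diff (chart p.1 p.1, chart p.2 p.2) (fst : E * F -> E) fst.
  by apply: is_diff_lin => // u; exact: cvg_fst.
apply: is_diff_near fd.
have cp := chart_param aX (dom_center aX p.1).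
have {}cp : \forall u \near ((chart p.1 p.1, chart p.2 p.2) : E * F),
  chart p.1 (param p.1 u.1) = u.1.
  apply: (@cvg_fst E F (nbhs (chart p.1 p.1)) (nbhs (chart p.2 p.2)) _
    (fun v => chart p.1 (param p.1 v) = v)).
  by apply: filterS cp => u [].
by apply: filterS cp => u uE; rewrite /in_charts /= uE.
Qed.

Lemma mdiff_snd E F (X : charted E) (Y : charted F) (p : prod_charted X Y) :
  atlas Y -> @mdiff _ _ (prod_charted X Y) Y snd p snd.
Proof.
move=> aY; split; first exact: cvg_snd.
have sd : is_diff (chart p.1 p.1, chart p.2 p.2) (snd : E * F -> F) snd.
  by apply: is_diff_lin => // u; exact: cvg_snd.
apply: is_diff_near sd.
have cp := chart_param aY (dom_center aY p.2).
have {}cp : \forall u \near ((chart p.1 p.1, chart p.2 p.2) : E * F),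
  chart p.2 (param p.2 u.2) = u.2.
  apply: (@cvg_snd E F (nbhs (chart p.1 p.1)) (nbhs (chart p.2 p.2)) _
    (fun v => chart p.2 (param p.2 v) = v)).
  by apply: filterS cp => u [].
by apply: filterS cp => u uE; rewrite /in_charts /= uE.
Qed.

Lemma mdiff_vec E F (f : E -> F) x L :
  is_diff x f L -> @mdiff _ _ (vec E) (vec F) f x L.
Proof. by move=> df; split=> //; case: df => [/differentiable_continuous]. Qed.

Lemma mdiff_real E (X : charted E) (f : X -> R) (x : X) :
  atlas X -> smooth_fun f ->
  @mdiff _ _ X line f x (differential f x).
Proof.
move=> aX sf; have xx := dom_center aX x.
have [] := sf x 1%N => df _; have {}df := df (chart x x) (ex_intro2 _ _ x xx erefl).
split; last exact: DiffDef df _.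
have cf : {for x, continuous (fun y => f (param x (chart x y)))}.
  apply: (@continuous_comp _ _ _ (chart x) (f \o param x)).
    exact: chart_continuous.
  exact: differentiable_continuous.
have fE : \forall y \near x, f (param x (chart x y)) = f y.
  by apply: filterS (near_dom aX x) => y xy; rewrite param_chart.
have {}cf : (fun y => f (param x (chart x y))) @ x --> f x.
  have fx : f (param x (chart x x)) = f x by rewrite (param_chart aX).
  by rewrite -[X in _ --> X]fx; exact: cf.
by apply: cvg_trans cf; apply: near_eq_cvg.
Qed.

(** * Curves with zero velocity *)

Lemma locally_cst (T : Type) (f : R -> T) :
  (forall s, \forall t \near s, f t = f s) -> forall s t, f s = f t.
Proof.
move=> fl s t; (* The indicator of a level set of [f] has zero derivative. *)
pose chi r : R := `[< f r = f t >]%:R.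
suff : chi s = chi t.
  rewrite /chi; case: asboolP => // _; case: asboolP => // _ /eqP.
  by rewrite eq_sym oner_eq0.
apply: is_derive_0_is_cst => r.
apply: near_eq_is_derive (is_derive_cst (chi r) r 1).
by apply: filterS (fl r) => r' fr; rewrite /chi fr.
Qed.

(** The mean value theorem on segments inside a ball around [s]. *)
Lemma is_diff0_near_cst (f : R -> R) (s : R) :
  (\forall t \near s, is_diff t f (fun _ => 0)) -> \forall t \near s, f t = f s.
Proof.
move=> /nbhs_ballP[e /= e0 sf].
have fd t : ball s e t -> is_derive t 1 f 0.
  move=> /sf[dft dfE]; apply: DeriveDef; first exact: diff_derivable.
  by rewrite deriveE// dfE.
have ab a b : ball s e a -> ball s e b -> a <= b -> f a = f b.
  move=> sa sb ab; have sx x : x \in `[a, b] -> ball s e x.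
    rewrite in_itv/= => /andP[ax xb]; move: sa sb.
    rewrite -!ball_normE /= !ltr_norml; lra.
  have [||c _] := @MVT_segment _ f (fun _ => 0) a b ab.
  - by move=> x /subset_itv_oo_cc/sx/fd.
  - apply: derivable_within_continuous => x /sx/fd. by case.
  - by rewrite mul0r => /eqP; rewrite subr_eq0 => /eqP.
apply/nbhs_ballP; exists e => // t st.
have ss : ball s e s by exact: ballxx.
by have [ts|/ltW st'] := leP t s; [exact: ab|apply/esym/ab].
Qed.

Section Curves.
Context n (X : charted (Cn R n)) (c : R -> X).
Hypothesis mX : complex_manifold X.

Let aX : atlas X. Proof. by case: mX. Qed.

(** The velocity at [t] is read in the chart centred at [c t]; the transition map carries its
    vanishing to the fixed chart at [c s]. Hence the coordinates of [c] are constant near [s], and a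
    locally constant curve is constant. *)
Lemma mdiff_curve_cst :
  (forall s, @mdiff _ _ line X c s (fun _ => 0)) ->
  forall s t, c s = c t.
Proof.
move=> c0; apply: locally_cst => s.
have cs : \forall t \near s, dom (c s) (c t).
  by have [ctu _] := c0 s; exact: ctu (near_dom aX (c s)).
pose h t : Cn R n := chart (c s) (c t).
have dh t : dom (c s) (c t) -> is_diff t h (fun _ => 0).
  move=> ct; have [ctu dt] := c0 t.
  have [_ _ _ /(_ (c t) (c s) (chart (c t) (c t)))] := mX.
  case=> [|dtr _]; first by exists (c t) => //; split=> //; exact: dom_center.
  have {}dtr := differentiableP dtr.
  have dth := is_diff_comp dt dtr.
  have -> : (fun _ => 0) = 'd (chart (c s) \o param (c t)) (chart (c t) (c t)) \o (fun _ : R => 0).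
    by apply/funext => r /=; rewrite linear0.
  apply: is_diff_near dth.
  have cd : \forall r \near t, dom (c t) (c r) by exact: ctu (near_dom aX (c t)).
  by apply: filterS cd => r tr; rewrite /h /in_charts /= param_chart.
have dhn : \forall t \near s, is_diff t h (fun _ => 0) by apply: filterS cs => t /dh.
have hs : \forall t \near s, h t = h s.
  (* The mean value theorem concerns scalar functions, hence the passage through real
     coordinates. *)
  have coordE (l : Cn R n -> R) : linear l -> \forall t \near s, l (h t) = l (h s).
    move=> ll; have lc := Cn_linear_continuous ll.
    apply: is_diff0_near_cst; apply: filterS dhn => t ht.
    have dl := is_diff_lin (h t) ll lc.
    have := is_diff_comp ht dl.
    rewrite (_ : l \o (fun _ : R => 0) = fun _ => 0)//.
    by apply/funext => r /=; exact: lin0.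
  have h1 : \forall t \near s, forall i : 'I_n, (h t).1 0 i = (h s).1 0 i.
    apply: (@filter_forall R _ (fun i t => (h t).1 0 i = (h s).1 0 i) (nbhs s)) => i.
    apply: (coordE (fun u => u.1 0 i)).
    by move=> a u v; rewrite /= !mxE.
  have h2 : \forall t \near s, forall i : 'I_n, (h t).2 0 i = (h s).2 0 i.
    apply: (@filter_forall R _ (fun i t => (h t).2 0 i = (h s).2 0 i) (nbhs s)) => i.
    apply: (coordE (fun u => u.2 0 i)).
    by move=> a u v; rewrite /= !mxE.
  apply: filterS2 h1 h2 => t h1 h2.
  rewrite [LHS]surjective_pairing [RHS]surjective_pairing.
  by congr (_, _); apply/rowP => i.
apply: filterS2 cs hs => t ct htE.
by rewrite -(param_chart aX ct) -[chart _ _]/(h t) htE /h param_chart//; exact: dom_center.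
Qed.
End Curves.
End Charted.

(** * Velocities of curves *)

Section Curves.
Context (R : realType).
Local Notation line := (line R).
Lemma is_derive1P (V : normedModType R) (f : R -> V) (s : R) (e : V) :
  is_derive s 1 f e <-> is_diff s f (fun u => u *: e).
Proof.
split=> [[df dfE]|[df dfE]].
  apply: DiffDef; first exact/derivable1_diffP.
  by rewrite diff1E; [apply/funext => u; rewrite derive1E dfE|exact/derivable1_diffP].
apply: DeriveDef; first exact/derivable1_diffP.
by rewrite deriveE// dfE scale1r.
Qed.

Lemma is_diff_line (V : normedModType R) (f : R -> V) (s : R) L :
  is_diff s f L -> is_derive s 1 f (L 1).
Proof.
move=> fL; apply/is_derive1P; rewrite (_ : (fun u : R => u *: L 1) = L)//.
apply/funext => u; have [_ <-] := fL.
by rewrite -linearZ /= -[u *: 1]/(u * 1) mulr1.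
Qed.

Lemma mdiff_curveP E (X : charted E) (c : line -> X) (s : R) (e : E) :
  mdiff c s (fun u : R => u *: e) <->
  {for s, continuous c} /\ is_derive s 1 (fun r => chart (c s) (c r) : E) e.
Proof. by split=> [[cc /is_derive1P]|[cc /is_derive1P]]. Qed.

Lemma mdiff_line E (X : charted E) (c : line -> X) (s : R) L :
  mdiff c s L -> mdiff c s (fun u : R => u *: L 1).
Proof. by move=> [cc /is_diff_line dc]; apply/mdiff_curveP. Qed.

Lemma mdiff_exp (s : R) :
  @mdiff _ _ _ line (C1_charted R) (fun t : R => (expR t, 0)) s
    (fun u : R => u *: (expR s, 0)).
Proof.
apply: mdiff_vec.
have e1 : is_diff s expR (fun u : R => u *: expR s).
  by apply/is_derive1P; exact: is_derive_expR.
have := is_diff_pair e1 (is_diff_cst (0 : R) s).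
congr (is_diff_def _ _ _); apply/funext => u.
by congr (_, _); rewrite /= scaler0.
Qed.

Lemma mdiff_expi (s : R) :
  @mdiff _ _ _ line (C1_charted R) (fun t : R => (cos t, sin t)) s
    (fun u : R => u *: (- sin s, cos s)).
Proof.
apply: mdiff_vec.
have e1 : is_diff s cos (fun u : R => u *: - sin s).
  by apply/is_derive1P; exact: is_derive_cos.
have e2 : is_diff s sin (fun u : R => u *: cos s).
  by apply/is_derive1P; exact: is_derive_sin.
exact: is_diff_pair e1 e2.
Qed.
End Curves.

(** * The gradient flow *)

Section Action.
Context (R : realType) (n : nat) (M : charted (Cn R n)).
Context (w : form2 M) (tau : R[i] -> M -> M) (phi : M -> R).
Hypothesis mM : complex_manifold M.
Hypothesis holtau : holomorphic_Cstar_action tau.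

Let aM : atlas M. Proof. by case: mM. Qed.
Let aC : atlas (C1_charted R) := @atlas_C1 R.
Let aL : atlas (line R) := @atlas_vec R _.
Let aCM : atlas (prod_charted (C1_charted R) M) := atlas_prod aC aM.

Definition act (zp : prod_charted (C1_charted R) M) : M := tau (to_C zp.1) zp.2.

Lemma act_mdiff zp : to_C zp.1 != 0 ->
  mdiff act zp (tangent act zp) /\
  forall u, tangent act zp (cJ u) = cJ (tangent act zp u).
Proof.
move=> zp0; have [_ _ h] := holtau; have [ca [da dJ]] := h zp zp0.
by split=> //; split=> //; exact: differentiableP.
Qed.

Definition sigma (s : R) (p : M) : M := tau (to_C (expR s, 0)) p.

Lemma to_C_exp_neq0 (s : R) : to_C (expR s, 0) != 0 :> R[i].
Proof. by rewrite eq_complex /= gt_eqF ?expR_gt0. Qed.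

Lemma expi_neq0 (s : R) : expi s != 0.
Proof.
rewrite eq_complex /=; apply/negP => /andP[/eqP c0 /eqP s0].
by have := cos2Dsin2 s; rewrite c0 s0 expr0n /= addr0 => /eqP; rewrite eq_sym oner_eq0.
Qed.

Lemma tau1 p : tau 1 p = p. Proof. by case: holtau. Qed.

Lemma tauM a b p : a != 0 -> b != 0 -> tau (a * b) p = tau a (tau b p).
Proof. by case: holtau => _ h _; exact: h. Qed.

Lemma sigma0 p : sigma 0 p = p.
Proof. by rewrite /sigma expR0; exact: tau1. Qed.

Lemma sigmaD s t p : sigma (s + t) p = sigma s (sigma t p).
Proof.
rewrite /sigma -tauM ?to_C_exp_neq0//; congr tau.
apply/eqP; rewrite eq_complex /= expRD; apply/andP; split; apply/eqP; ring.
Qed.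

Lemma sigmaK s : cancel (sigma s) (sigma (- s)).
Proof. by move=> p; rewrite -sigmaD addNr sigma0. Qed.

Lemma expiD s t : expi (s + t) = expi s * expi t :> R[i].
Proof. by apply/eqP; rewrite eq_complex /= cosD sinD eqxx addrC eqxx. Qed.

Lemma expi0 : expi 0 = 1 :> R[i].
Proof. by rewrite /expi cos0 sin0. Qed.

(** The velocity of [s |-> sigma s p] at 0: the tangent map of the action at z = 1 in the direction
    of the real axis. *)
Definition speed (p : M) : Cn R n := tangent act ((1, 0), p) ((1, 0), 0).

Lemma mdiff_act_at (s : line R) (z : line R -> C1_charted R) (e : C1 R) (p : M) :
  to_C (z s) != 0 -> mdiff z s (fun u : R => u *: e) ->
  mdiff (fun r => tau (to_C (z r)) p : M) s
    (fun u : R => u *: tangent act (z s, p) (e, 0)).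
Proof.
move=> zs0 dz; have [da _] := @act_mdiff (z s, p) zs0.
have := mdiff_comp aL aCM (mdiff_pair dz (mdiff_cst s p)) da.
move=> /mdiff_line /=; congr mdiff; apply/funext => u.
by rewrite scale1r.
Qed.

Lemma mdiff_sigma0 p : mdiff (fun s : line R => sigma s p) 0 (fun u : R => u *: speed p).
Proof.
have := mdiff_act_at p (to_C_exp_neq0 0) (mdiff_exp 0).
by rewrite expR0.
Qed.

Lemma mdiff_shift (s t : R) : @mdiff _ _ _ (line R) (line R) (fun r : R => r - t) s id.
Proof.
apply: mdiff_vec.
have := is_diffB (is_diff_id s) (is_diff_cst t s).
by rewrite subr0.
Qed.

(** By the group law, the velocity at time [s] is the velocity at time 0 of the orbit of
    [sigma s p]. *)
Lemma mdiff_sigma_curve s p :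
  mdiff (fun s : line R => sigma s p) s (fun u : R => u *: speed (sigma s p)).
Proof.
have d0 := mdiff_sigma0 (sigma s p).
have -> : (fun s : line R => sigma s p) =
    (fun r : line R => sigma r (sigma s p)) \o (fun r : R => r - s).
  by apply/funext => r /=; rewrite -sigmaD subrK.
rewrite -[X in mdiff _ X _](subrr s) in d0.
exact: (mdiff_comp aL aL (mdiff_shift s s) d0).
Qed.

(** Complex linearity of the tangent map of the action moves J to the factor C, where it turns the
    real direction into the imaginary one. *)
Lemma cJ_speed p : cJ (speed p) = tangent act ((1, 0), p) ((0, 1), 0).
Proof.
have [_ dJ] := @act_mdiff ((1, 0), p) (oner_neq0 _).
rewrite /speed -dJ; congr (tangent act _ (_, _)).
  by congr (_, _); rewrite /= oppr0.
by rewrite /= oppr0.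
Qed.

Lemma mdiff_expi_curve s p :
  mdiff (fun s : line R => tau (expi s) p : M) s
    (fun u : R => u *: cJ (speed (tau (expi s) p))).
Proof.
have d0 : mdiff (fun r : line R => tau (expi r) (tau (expi s) p) : M) 0
   (fun u : R => u *: cJ (speed (tau (expi s) p))).
  rewrite cJ_speed.
  have := mdiff_act_at (z := fun t : R => (cos t, sin t)) (tau (expi s) p)
    (expi_neq0 0) (mdiff_expi 0).
  by rewrite /= sin0 cos0 oppr0.
have -> : (fun s : line R => tau (expi s) p) =
    (fun r : line R => tau (expi r) (tau (expi s) p)) \o (fun r : R => r - s).
  by apply/funext => r /=; rewrite -tauM ?expi_neq0// -expiD subrK.
rewrite -[X in mdiff _ X _](subrr s) in d0.
exact: (mdiff_comp aL aL (mdiff_shift s s) d0).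
Qed.

Lemma generatorE p : generator tau p = cJ (speed p).
Proof.
have := mdiff_expi_curve 0 p.
rewrite expi0 tau1 => /mdiff_curveP[_]; rewrite expi0 tau1 => -[_ <-].
by rewrite /generator derive1E.
Qed.

Lemma mdiff_tau a p : a != 0 -> exists2 L, mdiff (tau a) p L & forall u, L (cJ u) = cJ (L u).
Proof.
move=> a0; pose z : C1_charted R := of_C a.
have zE : to_C z = a by case: a {a0} @z.
have z0 : to_C z != 0 by rewrite zE.
have [da dJ] := @act_mdiff (z, p) z0.
have := mdiff_comp aM aCM (mdiff_pair (mdiff_cst p z) (mdiff_id p aM)) da.
rewrite (_ : _ \o _ = tau a); last by apply/funext => q; rewrite /act /= zE.
move=> dt; eexists; first exact: dt.
move=> u; rewrite [RHS]/= -[RHS]dJ; congr (tangent act _ _).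
by congr (_, _); congr (_, _); rewrite /= oppr0.
Qed.

(** The tangent map of [tau a^-1] at [tau a p] is a left inverse, and in the next lemma a right
    inverse. *)
Lemma tangent_tau_inj a p L : a != 0 -> mdiff (tau a) p L -> injective L.
Proof.
move=> a0 da.
have a0' : a^-1 != 0 by rewrite invr_eq0.
have [L' da' _] := mdiff_tau (tau a p) a0'.
have := mdiff_comp aM aM da da'.
rewrite (_ : tau a^-1 \o tau a = id); last first.
  by apply/funext => q /=; rewrite -tauM// mulVf// tau1.
move=> /mdiff_unique/(_ (mdiff_id p aM)) LE.
by apply: (can_inj (g := L')) => u; have := congr1 (@^~ u) LE.
Qed.

Lemma tangent_tau_surj a p L : a != 0 -> mdiff (tau a) p L -> forall u, exists v, L v = u.
Proof.
move=> a0 da u.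
have a0' : a^-1 != 0 by rewrite invr_eq0.
have [L' da' _] := mdiff_tau (tau a p) a0'.
have tK : tau a^-1 (tau a p) = p by rewrite -tauM// mulVf// tau1.
rewrite -[X in mdiff _ X _]tK in da.
have := mdiff_comp aM aM da' da.
rewrite (_ : tau a \o tau a^-1 = id); last first.
  by apply/funext => q /=; rewrite -tauM// mulfV// tau1.
move=> /mdiff_unique/(_ (mdiff_id _ aM)) LE.
by exists (L' u); have := congr1 (@^~ u) LE.
Qed.

Lemma mdiff_sigma (s : R) p :
  exists L, @mdiff _ _ _ (prod_charted (line R) M) M (fun sp => sigma sp.1 sp.2) (s, p) L.
Proof.
have [da _] := @act_mdiff ((expR s, 0), p) (to_C_exp_neq0 s).
have d1 := mdiff_comp (atlas_prod aL aM) aL (@mdiff_fst _ _ _ (line R) M (s, p) aL)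
  (mdiff_exp s).
have := mdiff_comp (atlas_prod aL aM) aCM
  (mdiff_pair d1 (@mdiff_snd _ _ _ (line R) M (s, p) aM)) da.
by move=> ds; eexists; exact: ds.
Qed.

Lemma mdiff_opp (s : R) : @mdiff _ _ _ (line R) (line R) -%R s -%R.
Proof. by apply: mdiff_vec; exact: is_diffN (is_diff_id s). Qed.

(* The action of [expi s] carries the orbit near 0 to the orbit near [s], so the
   velocity vanishes at every time. *)
Lemma speed0_fixed p : speed p = 0 -> forall s, tau (expi s) p = p.
Proof.
move=> p0 s; rewrite -[RHS]tau1 -expi0.
apply: (@mdiff_curve_cst R n M (fun s => tau (expi s) p) mM) => {}s.
have [L dL _] := mdiff_tau p (expi_neq0 s).
have d0 := mdiff_expi_curve 0 p.
rewrite expi0 tau1 p0 -[X in mdiff _ X _](subrr s) in d0.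
have d1 := mdiff_comp aL aL (mdiff_shift s s) d0.
rewrite -[p in mdiff (tau _) p](tau1 p) -expi0 -(subrr s) in dL.
have := mdiff_comp aL aM d1 dL.
congr (mdiff _ _ _); apply/funext => u.
  by rewrite /= -tauM ?expi_neq0// -expiD addrC subrK.
change (L (u *: cJ 0) = 0); by rewrite cJ0 scaler0 lin0//; exact: mdiff_linear dL.
Qed.

(* At each time [t], [c] and [r |-> sigma (r - t) (c t)] have the same velocity,
   and [sigma (- r)] maps the latter to a constant; so [sigma (- r) (c r)] has
   velocity zero. *)
Lemma integral_curve_sigma c t : integral_curve speed c -> c t = sigma t (c 0).
Proof.
move=> [cc dc].
have mc s : mdiff (c : line R -> M) s (fun u : R => u *: speed (c s)).
  by apply/mdiff_curveP; split; [exact: cc|exact: dc].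
suff : sigma (- t) (c t) = c 0 by move=> <-; rewrite -sigmaD subrr sigma0.
rewrite (_ : c 0 = sigma (- 0) (c 0)); last by rewrite oppr0 sigma0.
apply: (@mdiff_curve_cst R n M (fun s => sigma (- s) (c s)) mM) => {}t.
have [L dL] := mdiff_sigma (- t) (c t).
have d1 := mdiff_comp aL (atlas_prod aL aM) (mdiff_pair (mdiff_opp t) (mc t)) dL.
have d0 := mdiff_sigma0 (c t).
rewrite -[X in mdiff _ X _](subrr t) in d0.
have de := mdiff_comp aL aL (mdiff_shift t t) d0.
have eE : sigma (t - t) (c t) = c t by rewrite subrr sigma0.
rewrite -[in X in mdiff _ X _]eE in dL.
have := mdiff_comp aL (atlas_prod aL aM) (mdiff_pair (mdiff_opp t) de) dL.
rewrite (_ : _ \o _ = fun=> sigma (- t) (c t)); last first.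
  by apply/funext => r /=; rewrite -sigmaD addrA addNr add0r.
move=> /mdiff_unique/(_ (mdiff_cst _ _)) E0.
by rewrite -[X in mdiff _ _ X]E0; exact: d1.
Qed.

Lemma sigma_integral_curve p : integral_curve speed (sigma ^~ p).
Proof.
split=> s; first by have [] := mdiff_sigma_curve s p.
by have /mdiff_curveP[] := mdiff_sigma_curve s p.
Qed.

(** The choice in [exp_field] is over a singleton: [sigma] gives an integral curve, and every other
    one from [p] equals it. *)
Lemma exp_speed t p : exp_field speed t p = sigma t p.
Proof.
rewrite /exp_field; case: xgetP => [_ -> [c [/integral_curve_sigma cE <- <-]]//|].
move=> /(_ (sigma t p)) []; exists (sigma ^~ p).
by split; [exact: sigma_integral_curve|exact: sigma0|].
Qed.

(** * The gradient of the moment map *)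

Section Moment.
Hypothesis kw : kahler_form w.
Hypothesis ham : hamiltonian w tau phi.

Let w_linear p c u v t : w p (c *: u + v) t = c * w p u t + w p v t.
Proof.
have [[wl wN] _ _ _ _] := kw.
by rewrite (wN p _ t) wl (wN p t u) (wN p t v); ring.
Qed.

(** The moment map equation for the generator is w(J speed, u) = - d phi(u), and J-invariance gives
    w(speed, J u) = w(J speed, - u). *)
Lemma metric_speed p u : metric w p (speed p) u = differential phi p u.
Proof.
have [[wl wN] _ _ wJ _] := kw; have [_ _ hg] := ham.
have := hg p u; rewrite generatorE => /eqP; rewrite -eqr_oppLR => /eqP <-.
rewrite /metric -wN -wJ cJK.
rewrite wN.
have -> : - u = -1 *: u + 0 :> Cn R n by rewrite scaleN1r addr0.
have w0 q t : w q 0 t = 0.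
  by have := w_linear q 1 0 0 t; rewrite scale1r addr0; lra.
by rewrite w_linear w0; ring.
Qed.

Lemma gradient_speed : gradient w phi = speed.
Proof.
apply/funext => p; rewrite /gradient; case: xgetP => [v _ vE|/(_ (speed p))[]]; last first.
  exact: metric_speed.
have [_ _ _ _ pos] := kw.
(* Uniqueness of the gradient: [v - speed p] is orthogonal to every vector, in particular to
   itself. *)
apply/eqP; rewrite -subr_eq0; apply: contraT => /(pos p).
rewrite /metric -[X in w p X](_ : -1 *: speed p + v = _); last by rewrite scaleN1r addrC.
rewrite w_linear -[w _ v _]/(metric w p v _) vE -[w _ (speed p) _]/(metric w p _ _).
by rewrite metric_speed mulN1r addNr ltxx.
Qed.

Lemma mdiff_phi p : @mdiff _ _ _ M (line R) phi p (differential phi p).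
Proof. by apply: mdiff_real => //; case: ham. Qed.

Lemma phi_continuous : continuous phi.
Proof. by move=> p; have [] := mdiff_phi p. Qed.

Lemma phi_sigma_derive (s : R) p :
  is_derive s (1 : R) (fun r : R => phi (sigma r p))
    (metric w (sigma s p) (speed (sigma s p)) (speed (sigma s p))).
Proof.
have := mdiff_comp aL aM (mdiff_sigma_curve s p) (mdiff_phi _).
move=> /mdiff_line/mdiff_curveP[_].
by rewrite /= scale1r metric_speed.
Qed.

Lemma metric_ge0 p u : 0 <= metric w p u u.
Proof.
have [_ _ _ _ pos] := kw; have [->|/(pos p)/ltW//] := eqVneq u 0.
by have := w_linear p 1 0 0 (cJ 0); rewrite scale1r addr0 /metric; lra.
Qed.

Lemma metric_gt0 p u : u != 0 -> 0 < metric w p u u.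
Proof. by have [_ _ _ _ pos] := kw; exact: pos. Qed.

(** Along the circle orbit the derivative of [phi] is the metric product of speed and J speed, that
    is - w(speed, speed) = 0. *)
Lemma phi_expi s p : phi (tau (expi s) p) = phi p.
Proof.
rewrite -[in RHS](tau1 p) -expi0.
apply: (@is_derive_0_is_cst _ (fun s => phi (tau (expi s) p))) => {}s.
have := mdiff_comp aL aM (mdiff_expi_curve s p) (mdiff_phi _).
move=> /mdiff_line/mdiff_curveP[_].
rewrite /= scale1r -metric_speed /metric.
have [[wl wN] _ _ wJ _] := kw.
have -> : cJ (cJ (speed (tau (expi s) p))) = - 1 *: speed (tau (expi s) p) + 0 :> Cn R n.
  by rewrite cJK scaleN1r addr0.
have w0 q t : w q t 0 = 0.
  by have := wl q 1 t 0 0; rewrite scale1r addr0; lra.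
have ww q t : w q t t = 0 by have := wN q t t; lra.
by rewrite wl w0 ww mulr0 addr0.
Qed.

End Moment.
End Action.

(** * The height function *)

Section Polar.
Context (R : realType).

(** The angle [acos x] has sine [|y|]; the sign of [y] decides between it and its opposite. *)
Lemma norm1_expi (x y : R) : x ^+ 2 + y ^+ 2 = 1 -> exists t, expi t = Complex x y.
Proof.
move=> xy1.
have x1 : -1 <= x <= 1 by apply/andP; split; nra.
have cx : cos (acos x) = x by apply: acosK; rewrite in_itv.
have sx : sin (acos x) = `|y|.
  by rewrite sin_acos// -xy1 addrC addKr sqrtr_sqr.
have [y0|/ltW y0] := leP 0 y.
  by exists (acos x); rewrite /expi cx sx ger0_norm.
by exists (- acos x); rewrite /expi cosN sinN cx sx ler0_norm// opprK.
Qed.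

Lemma normc_expi (t : R) : `|expi t| = 1 :> R[i].
Proof. by rewrite normc_def /= cos2Dsin2 sqrtr1. Qed.

Lemma normc1_expi (a : R[i]) : `|a| = 1 -> exists t, expi t = a.
Proof.
case: a => x y; rewrite normc_def /= => /eqP.
rewrite eq_complex /= => /andP[/eqP h _]; apply: norm1_expi.
by rewrite -[LHS]sqr_sqrtr ?h ?expr1n// addr_ge0// sqr_ge0.
Qed.

Lemma polar (a : R[i]) : a != 0 -> exists s t, a = to_C (expR s, 0) * expi t.
Proof.
case: a => x y; rewrite eq_complex /= negb_and => xy0.
pose r := Num.sqrt (x ^+ 2 + y ^+ 2).
have r0 : 0 < r.
  rewrite sqrtr_gt0 lt_def addr_ge0 ?sqr_ge0// andbT paddr_eq0 ?sqr_ge0//.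
  by rewrite !sqrf_eq0 negb_and.
have r2 : r ^+ 2 = x ^+ 2 + y ^+ 2 by rewrite sqr_sqrtr// addr_ge0// sqr_ge0.
have rn0 : r != 0 by rewrite gt_eqF.
have [|t tE] := @norm1_expi (x / r) (y / r).
  by rewrite !expr_div_n -mulrDl -r2 divff// expf_neq0.
exists (ln r), t; rewrite tE lnK ?posrE//.
by apply/eqP; rewrite eq_complex /=; apply/andP; split; apply/eqP; field.
Qed.
End Polar.

Section Height.
Context (R : realType) (n : nat) (M : charted (Cn R n)).
Context (w : form2 M) (tau : R[i] -> M -> M) (phi : M -> R) (lam : R).
Hypothesis mM : complex_manifold M.
Hypothesis holtau : holomorphic_Cstar_action tau.
Hypothesis kw : kahler_form w.
Hypothesis ham : hamiltonian w tau phi.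
Hypothesis free : free_on tau [set p | phi p = lam].

Let aM : atlas M. Proof. by case: mM. Qed.
Let aL : atlas (line R) := @atlas_vec R _.

Local Notation sigma := (sigma tau).
Local Notation speed := (speed tau).

(* [height r s = lam] iff [(sigma s r, e^s)] lies on the level set of the cut
   moment map. *)
Definition height (r : M) (s : R) : R := phi (sigma s r) + expR s ^+ 2.

(** The squared length of the gradient at [sigma s p], which is the derivative of [phi] along the
    flow line of [p]. *)
Let grad2 s p := metric w (sigma s p) (speed (sigma s p)) (speed (sigma s p)).

Lemma phi_sigma_continuous p : continuous (fun s : R => phi (sigma s p)).
Proof.
move=> s; apply: differentiable_continuous; apply/derivable1_diffP.
by have [] := phi_sigma_derive mM holtau kw ham s p.
Qed.

Lemma phi_sigma_MVT p a b : a < b -> exists2 c, c \in `]a, b[ &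
  phi (sigma b p) - phi (sigma a p) = grad2 c p * (b - a).
Proof.
move=> ab; apply: (MVT (f := fun s => phi (sigma s p))) => // [x _|].
  exact: phi_sigma_derive.
apply: continuous_subspaceT; exact: phi_sigma_continuous.
Qed.

Lemma phi_sigma_le p a b : a <= b -> phi (sigma a p) <= phi (sigma b p).
Proof.
rewrite le_eqVlt => /predU1P[->//|ab].
have [c _ cE] := phi_sigma_MVT p ab.
rewrite -subr_ge0 cE mulr_ge0//; first exact: metric_ge0.
by rewrite subr_ge0 ltW.
Qed.

Lemma height_lt r a b : a < b -> height r a < height r b.
Proof.
move=> ab; rewrite /height ler_ltD// ?phi_sigma_le ?ltW//.
by rewrite ltr_pXn2r// ?nnegrE ?expR_ge0// ltr_expR.
Qed.

Lemma height_inj r : injective (height r).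
Proof.
move=> a b hab; apply/eqP; rewrite eq_le !leNgt; apply/andP; split;
by apply/negP => /(height_lt r); rewrite hab ltxx.
Qed.

Lemma height_continuous r : continuous (height r).
Proof.
move=> s; apply: (@continuousD _ _ _ (fun s => phi (sigma s r)) (fun s => expR s ^+ 2)).
  exact: phi_sigma_continuous.
apply: (@continuous_comp _ _ _ expR (fun x : R => x ^+ 2)).
  exact: continuous_expR.
exact: exprn_continuous.
Qed.

Lemma height_IVT r a b : height r a < lam -> lam < height r b ->
  exists2 s, s \in `]a, b[ & height r s = lam.
Proof.
move=> ra rb; have ab : a < b.
  rewrite ltNge le_eqVlt; apply/negP => /predU1P[ba|/(height_lt r) ba].
    by have := lt_trans ra rb; rewrite ba ltxx.
  by have := lt_trans (lt_trans ba ra) rb; rewrite ltxx.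
have [||s] := @IVT R (height r) a b lam (ltW ab).
- exact/continuous_subspaceT/height_continuous.
- by rewrite ge_min le_max (ltW ra) (ltW rb) orbT.
rewrite in_itv/= => /andP[as_ sb] sE; exists s => //.
rewrite in_itv/= !lt_neqAle as_ sb !andbT; apply/andP; split; apply: contraTneq isT => h.
  by move: ra; rewrite h sE ltxx.
by move: rb; rewrite -h sE ltxx.
Qed.

(** If [phi] did not decrease strictly, the mean value theorem would give a zero of the gradient at
    an intermediate point. By monotonicity this point is on the level set, and the circle fixes it,
    against freeness. *)
Lemma free_phi_lt p s : phi p = lam -> s < 0 -> phi (sigma s p) < lam.
Proof.
move=> plam s0; have := phi_sigma_le p (ltW s0); rewrite (sigma0 holtau) plam => sle.
rewrite lt_neqAle sle andbT; apply/eqP => sE.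
have [c] := phi_sigma_MVT p s0.
rewrite in_itv/= => /andP[sc c0]; rewrite sE (sigma0 holtau) plam subrr => /esym/eqP.
rewrite mulf_eq0 [X in _ || X](negbTE _) ?orbF; last by rewrite sub0r oppr_eq0 lt_eqF.
move=> /eqP g0.
have v0 : speed (sigma c p) = 0.
  apply/eqP; apply: contraT => /(metric_gt0 kw (sigma c p)).
  by rewrite -/(grad2 c p) g0 ltxx.
have clam : phi (sigma c p) = lam.
  apply/eqP; rewrite eq_le; apply/andP; split.
    by have := phi_sigma_le p (ltW c0); rewrite (sigma0 holtau) plam.
  by rewrite -sE phi_sigma_le// ltW.
(* Half a turn, [pi] being the number, suffices: [expi pi] is -1, not 1. *)
have fix_ := speed0_fixed mM holtau v0 pi.
have := free clam (normc_expi pi) fix_.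
move=> /eqP; rewrite eq_complex /= cospi sinpi eqxx andbT => /eqP h.
have : (2 : R) = 0 by rewrite -[2]/(1 + 1) -{1}h addNr.
by move/eqP; rewrite pnatr_eq0.
Qed.

(** Shown in [M_sharpE] to be M^#; in this form openness and the inverse of g are accessible. *)
Definition reach : set M := [set r | exists s, height r s = lam].

(** A time of height below [lam] is found far in the past, where [phi] is at most [phi (sigma a r)]
    and e^{2s} is small. *)
Lemma reach_of r a b : phi (sigma a r) < lam -> lam < height r b -> reach r.
Proof.
move=> ra rb.
(* As [m] is less than 1 and than the gap [lam - phi (sigma a r)], so is its square, which bounds
   e^{2s} for s at most [ln m]. *)
pose m := Num.min 1 (lam - phi (sigma a r)) / 2.
have m0 : 0 < m by rewrite divr_gt0// lt_min ltr01 subr_gt0.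
have m1 : m < 1.
  rewrite ltr_pdivrMr// mul1r (@le_lt_trans _ _ 1) ?ltr1n//.
  by rewrite ge_min lexx.
have md : m < lam - phi (sigma a r).
  rewrite ltr_pdivrMr// mulr_natr mulr2n (@le_lt_trans _ _ (lam - phi (sigma a r)))//.
    by rewrite ge_min lexx orbT.
  by rewrite ltrDl subr_gt0.
have sl : height r (Num.min a (ln m)) < lam.
  rewrite /height (@le_lt_trans _ _ (phi (sigma a r) + m ^+ 2))//.
    have em : expR (Num.min a (ln m)) <= m.
      by rewrite -[X in _ <= X]lnK ?posrE// ler_expR ge_min lexx orbT.
    rewrite lerD//; first by rewrite phi_sigma_le// ge_min lexx.
    by rewrite ler_pXn2r// nnegrE ?expR_ge0// ltW.
  by nra.
by have [s _ sE] := height_IVT sl rb; exists s.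
Qed.

Lemma M_sharpE : M_sharp tau phi lam = reach.
Proof.
apply/seteqP; split=> [q [qlam|[a [p [a0 plam ->]]]]|q [s sE]].
(* For d = lam - phi q > 0 the term e^{2d} >= (1 + d)^2 > d alone lifts the height above [lam]. *)
- apply: (@reach_of q 0 (lam - phi q)); first by rewrite (sigma0 holtau).
  have d0 : 0 < lam - phi q by rewrite subr_gt0.
  have := phi_sigma_le q (ltW d0); rewrite (sigma0 holtau) /height => h.
  have := expR_ge1Dx (lam - phi q); nra.
(* The rotation keeps [p] on the level set. Flowing back one unit beyond that level brings [phi]
   below [lam] by freeness, and on the level itself the height exceeds [lam]. *)
- have [s [t aE]] := polar a0.
  pose p' := tau (expi t) p.
  have p'lam : phi p' = lam by rewrite /p' (phi_expi mM holtau kw ham).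
  have -> : tau a p = sigma s p'.
    by rewrite aE (tauM holtau) ?expi_neq0 ?to_C_exp_neq0.
  apply: (@reach_of _ (- s - 1) (- s)).
    by rewrite -(sigmaD holtau) addrAC addNr sub0r free_phi_lt// oppr_lt0.
  by rewrite /height (sigmaK holtau) p'lam ltrDl exprn_gt0// expR_gt0.
(* If [phi q >= lam], the flow line crosses the level [lam] between [s] and 0, so [q] is stable. *)
- have [qlam|lamq] := ltP (phi q) lam; [by left|right].
  have slam : phi (sigma s q) < lam by rewrite -sE ltrDl exprn_gt0// expR_gt0.
  have s0 : s <= 0.
    rewrite leNgt; apply/negP => /ltW /(phi_sigma_le q).
    rewrite (sigma0 holtau) => h; have := lt_le_trans (le_lt_trans h slam) lamq.
    by rewrite ltxx.
  have [||c _ cE] := @IVT R (fun s => phi (sigma s q)) s 0 lam s0.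
  + exact/continuous_subspaceT/phi_sigma_continuous.
  + by rewrite (sigma0 holtau) ge_min le_max (ltW slam) lamq orbT.
  exists (to_C (expR (- c), 0)), (sigma c q); split=> //.
    exact: to_C_exp_neq0.
  by rewrite -[RHS]/(sigma (- c) (sigma c q)) (sigmaK holtau).
Qed.

(** The heights at [s0 - e] and [s0 + e] lie strictly on either side of [lam], and still do near
    [r0]. This yields both openness of [reach] and continuity of [htime]. *)
Lemma near_reach r0 s0 (e : R) : height r0 s0 = lam -> 0 < e ->
  \forall r \near r0, exists2 s, `|s - s0| < e & height r s = lam.
Proof.
move=> h0 e0.
have hc s : {for r0, continuous (fun r => height r s)}.
  have [L [ctau _] _] := mdiff_tau mM holtau r0 (to_C_exp_neq0 s).
  apply: (@continuousD _ _ _ (fun r => phi (sigma s r))); last exact: cst_continuous.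
  by apply: continuous_comp; [exact: ctau|exact: phi_continuous mM ham _].
have l1 : height r0 (s0 - e) < lam by rewrite -h0 height_lt// ltrBlDr ltrDl.
have l2 : lam < height r0 (s0 + e) by rewrite -h0 height_lt// ltrDl.
have n1 : \forall r \near r0, height r (s0 - e) < lam.
  exact: (hc _ _ (lt_nbhsl l1)).
have n2 : \forall r \near r0, lam < height r (s0 + e).
  exact: (hc _ _ (lt_nbhsr l2)).
apply: filterS2 n1 n2 => r r1 r2.
have [s] := height_IVT r1 r2; rewrite in_itv/= => /andP[a b] sE.
by exists s => //; rewrite ltr_norml; apply/andP; split; lra.
Qed.

Lemma open_reach : open reach.
Proof.
rewrite openE => r [s sE]; have := near_reach sE ltr01.
by apply: filterS => r' [s' _ s'E]; exists s'.
Qed.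

Definition htime (r : M) : R := xget 0 [set s | height r s = lam].

Lemma htimeP r : reach r -> height r (htime r) = lam.
Proof. by move=> [s sE]; rewrite /htime; case: xgetP => // /(_ s). Qed.

Lemma htime_eq r s : height r s = lam -> htime r = s.
Proof. by move=> sE; apply: (@height_inj r); rewrite htimeP// ?sE//; exists s. Qed.

Lemma htime_continuous r : reach r -> {for r, continuous htime}.
Proof.
move=> rr; apply/cvgrPdist_lt => e e0.
apply: filterS (near_reach (htimeP rr) e0) => r' [s se /htime_eq ->].
by rewrite distrC.
Qed.

(** The time derivative is the squared length of the gradient plus 2 e^{2s}; its positivity is what
    the implicit function theorem asks for. *)
Lemma mdiff_height r s :
  exists2 L, @mdiff _ _ _ (prod_charted M (line R)) (line R) (fun rs => height rs.1 rs.2) (r, s) L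
   & 0 < L (0, 1).
Proof.
have aML : atlas (prod_charted M (line R)) by exact: atlas_prod.
have aLM : atlas (prod_charted (line R) M) by exact: atlas_prod.
have [L dL] := mdiff_sigma mM holtau s r.
have d1 := @mdiff_fst _ _ _ M (line R) (r, s) aM.
have d2 := @mdiff_snd _ _ _ M (line R) (r, s) aL.
have d3 := mdiff_comp aML aLM (mdiff_pair d2 d1) dL.
have d4 := mdiff_comp aML aM d3 (mdiff_phi mM ham (sigma s r)).
have d5 : @mdiff _ _ _ (line R) (line R) (fun t : R => expR t ^+ 2) s
    (fun u : R => u *: (2 * expR s ^+ 2)).
  apply: mdiff_vec; apply/is_derive1P.
  have := is_deriveM (is_derive_expR s) (is_derive_expR s).
  rewrite (_ : _ + _ = 2 * expR s ^+ 2)//.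
  by rewrite -[_ *: _]/(_ * _) mulr_natl mulr2n.
have d6 := mdiff_comp aML aL d2 d5.
have d7 : @mdiff _ _ _ (prod_charted M (line R)) (line R) (fun rs => height rs.1 rs.2) (r, s)
    (fun u => differential phi (sigma s r) (L (u.2, u.1)) + u.2 *: (2 * expR s ^+ 2)).
  split; first exact: continuousD d4.1 d6.1.
  exact: is_diffD d4.2 d6.2.
eexists; first exact: d7.
rewrite /= scale1r ltr_wpDl ?mulr_gt0 ?exprn_gt0 ?expR_gt0//.
(* Freezing [r] identifies [L (1, 0)] with the velocity of the flow line. *)
have d8 := mdiff_comp aL aLM (mdiff_pair (mdiff_id s aL) (mdiff_cst s r)) dL.
have := mdiff_unique d8 (mdiff_sigma_curve mM holtau s r).
move=> /(congr1 (@^~ 1)) /= ->.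
by rewrite scale1r -(metric_speed mM holtau kw ham) metric_ge0.
Qed.

Lemma mdiff_htime r : reach r -> exists L, @mdiff _ _ _ M (line R) htime r L.
Proof.
move=> rr; have [L [_ dL] L0] := mdiff_height r (htime r).
have ch := htime_continuous rr.
have lL := is_diff_linear dL.
have rr0 := dom_center aM r.
pose y u := htime (param r u).
have cy : {for chart r r, continuous y}.
  apply: (@continuous_comp _ _ _ (param r) htime); first exact: param_continuous.
  exact: (eq_ind_r (fun z => {for z, continuous htime}) ch (param_chart aM rr0)).
have yE : y (chart r r) = htime r by rewrite /y param_chart.
have {}dL : is_diff (chart r r, y (chart r r))
    (fun us : Cn R n * R => height (param r us.1) us.2 : R) L.
  by rewrite yE.
eexists; split; first exact: ch.
(* In the chart at [r], with [A] the division by the time derivative of the height. *)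
apply: (implicit_is_diff (A := fun z => (L (0, 1))^-1 *: z) dL cy).
- have : \forall x \near r, height x (htime x) = lam.
    apply: (@filterS _ (nbhs r) _ reach) => [x|]; first exact: htimeP.
    exact: open_nbhs_nbhs (conj open_reach rr).
  move=> /(near_param aM rr0).
  by apply: filterS => u uE; rewrite yE /= (param_chart aM rr0) htimeP.
- by move=> a u v; rewrite scalerDr !scalerA [a * _]mulrC.
- exact: scaler_continuous.
- move=> k; rewrite (_ : (0, k) = k *: (0, 1)); last first.
    by congr (_, _); rewrite /= ?scaler0//; rewrite -[k *: 1]/(k * 1) mulr1.
  rewrite linZ// -[RHS]mulr1 -[k *: L _]/(k * L _) -[_ *: _]/(_ * _).
  by field; rewrite gt_eqF.
Qed.

End Height.

(** * The cut near the open stratum *)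

Section CutGeometry.
Context (R : realType) (n : nat) (M : charted (Cn R n)).
Context (w : form2 M) (tau : R[i] -> M -> M) (phi : M -> R) (lam : R).
Hypothesis mM : complex_manifold M.
Hypothesis holtau : holomorphic_Cstar_action tau.
Hypothesis kw : kahler_form w.
Hypothesis ham : hamiltonian w tau phi.

Let aM : atlas M. Proof. by case: mM. Qed.
Let aL : atlas (line R) := @atlas_vec R _.
Let aC : atlas (C1_charted R) := @atlas_C1 R.
Let aX : atlas (MxC M) := atlas_prod aM aC.

Local Notation sigma := (sigma tau).
Local Notation speed := (speed tau).
Local Notation X := (MxC M).
Local Notation V := (cprod (Cn R n) (C1 R)).
Local Notation om := (cut_form w).
Local Notation psi := (cut_moment phi : X -> R).
Implicit Types (x : X).

(** * The Kähler form, circle action and moment map on M x C *)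

Lemma V_cJK (u : V) : cJ (cJ u) = - u.
Proof. by case: u => -[a b] [c d]. Qed.

Lemma om_linear x c (u v t : V) : om x (c *: u + v) t = c * om x u t + om x v t.
Proof.
have [[wl wN] _ _ _ _] := kw.
rewrite /cut_form /= (wN x.1 _ t.1) wl (wN x.1 t.1 u.1) (wN x.1 t.1 v.1).
by rewrite -[c *: u.2.1]/(c * u.2.1) -[c *: u.2.2]/(c * u.2.2); ring.
Qed.

Lemma om_anti x (u v : V) : om x u v = - om x v u.
Proof.
have [[_ wN] _ _ _ _] := kw.
by rewrite /cut_form /= (wN x.1 u.1); ring.
Qed.

Lemma om_J x (u v : V) : om x (cJ u) (cJ v) = om x u v.
Proof.
have [_ _ _ wJ _] := kw.
rewrite /cut_form; congr (_ + _); first exact: wJ.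
by rewrite /=; ring.
Qed.

Lemma om_pos x (u : V) : u != 0 -> 0 < om x u (cJ u).
Proof.
case: u => a b ab0; have [_ _ _ _ pos] := kw.
have -> : om x (a, b) (cJ ((a, b) : V)) = metric w x.1 a a + 2 * (b.1 ^+ 2 + b.2 ^+ 2).
  by rewrite /cut_form /metric /=; congr (_ + _); ring.
have [b0|b0] := eqVneq b 0.
  rewrite b0 /= expr0n /= addr0 mulr0 addr0; apply: pos.
  by move: ab0; apply: contra => /eqP ->; rewrite b0.
rewrite ltr_wpDl ?metric_ge0//.
rewrite mulr_gt0// lt_def addr_ge0 ?sqr_ge0// andbT paddr_eq0 ?sqr_ge0// !sqrf_eq0.
move: b0; apply: contra => /andP[/eqP b1 /eqP b2].
by case: b b1 b2 {ab0} => /= c d -> ->.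
Qed.

Lemma om0l x (v : V) : om x 0 v = 0.
Proof. by have := om_linear x 1 0 0 v; rewrite scale1r addr0; lra. Qed.

Lemma om_self x (u : V) : om x u u = 0.
Proof. by have := om_anti x u u; lra. Qed.

(** The generator of the diagonal circle action, as [generator_cut] confirms. *)
Definition gen x : V := (cJ (speed x.1), cJ (x.2 : C1 R)).

Lemma mdiff_rotation (z : C1 R) :
  @mdiff _ _ _ (line R) (C1_charted R) (fun t : R => of_C (expi t * to_C z)) 0
    (fun s : R => s *: cJ z).
Proof.
apply: mdiff_vec.
have dc a : is_derive (0 : R) 1 (fun r : R => cos r * a) 0.
  have := is_deriveZ a (is_derive_cos (0 : R)); rewrite sin0 oppr0 scaler0.
  by congr is_derive; apply/funext => r; rewrite mulrC.
have ds a : is_derive (0 : R) 1 (fun r : R => sin r * a) a.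
  have := is_deriveZ a (is_derive_sin (0 : R)).
  rewrite cos0 (_ : a *: 1 = a); last exact: mulr1.
  by congr is_derive; apply/funext => r; rewrite mulrC.
have /is_derive1P e1 := is_deriveB (dc z.1) (ds z.2).
have /is_derive1P e2 := is_deriveD (dc z.2) (ds z.1).
have := is_diff_pair e1 e2; congr is_diff_def.
by apply/funext => s /=; rewrite sub0r add0r.
Qed.

Lemma mdiff_orbit x :
  mdiff (fun t : line R => cut_action tau (expi t) x : X) 0 (fun s : R => s *: gen x).
Proof.
have d1 := mdiff_expi_curve mM holtau 0 x.1.
rewrite expi0 (tau1 holtau) in d1.
exact: mdiff_pair d1 (mdiff_rotation x.2).
Qed.

Lemma cut_action1 x : cut_action tau 1 x = x.
Proof. by case: x => p [a b]; rewrite /cut_action (tau1 holtau) mul1r. Qed.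

Lemma generator_cut x : generator (cut_action tau : R[i] -> X -> X) x = gen x.
Proof.
have /mdiff_curveP[_] := mdiff_orbit x.
rewrite expi0 cut_action1.
by case=> _ <-; rewrite /generator derive1E.
Qed.

(** The moment map equation on the product: on C, contracting 2 dx /\ dy with iz gives - d|z|^2. *)
Lemma mdiff_psi x : @mdiff _ _ _ X (line R) psi x (fun u => - om x (gen x) u).
Proof.
have d1 := @mdiff_fst _ _ _ M (C1_charted R) x aM.
have d2 := @mdiff_snd _ _ _ M (C1_charted R) x aC.
have d3 := mdiff_comp aX aM d1 (mdiff_phi mM ham x.1).
have sqd (g : R * R -> R) (z : R * R) : linear g -> continuous g ->
    is_diff z (fun y => g y ^+ 2) (fun u => 2 * g z * g u).
  move=> lg cg.
  have dg := is_diff_lin z lg cg.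
  have := is_diffM dg dg; congr is_diff_def.
  by apply/funext => u; rewrite -[LHS]/(g z * g u + g z * g u); ring.
have l1 : linear (fst : R * R -> R) by [].
have l2 : linear (snd : R * R -> R) by [].
have e1 := sqd _ x.2 l1 (fun z => cvg_fst).
have e2 := sqd _ x.2 l2 (fun z => cvg_snd).
have d4 : @mdiff _ _ _ (C1_charted R) (line R) (fun z : R * R => z.1 ^+ 2 + z.2 ^+ 2) x.2
    (fun u : R * R => 2 * x.2.1 * u.1 + 2 * x.2.2 * u.2).
  by apply: mdiff_vec; exact: is_diffD e1 e2.
have d5 := mdiff_comp aX aC d2 d4.
have d6 : @mdiff _ _ _ X (line R) psi x
    (fun u => differential phi x.1 u.1 + (2 * x.2.1 * u.2.1 + 2 * x.2.2 * u.2.2)).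
  split; last exact: is_diffD d3.2 d5.2.
  exact: (@continuousD _ _ _ _ _ x d3.1 d5.1).
move: d6; congr mdiff; apply/funext => u.
have [_ _ /(_ x.1 u.1)] := ham; rewrite (generatorE mM holtau) => hE.
by rewrite /cut_form [(gen x).1]/= hE /=; ring.
Qed.

Lemma differential_psi x u : differential psi x u = - om x (gen x) u.
Proof. by rewrite -[LHS]/(tangent (psi : X -> line R) x u) (mdiff_tangent (mdiff_psi x)). Qed.

Lemma psi_orbit (t : R) x : psi (cut_action tau (expi t) x) = psi x.
Proof.
rewrite /cut_moment /= (phi_expi mM holtau kw ham); congr (_ + _).
have := cos2Dsin2 t; case: x => p [a b] /= cs.
by rewrite -[RHS]mul1r -cs; ring.
Qed.

Definition stable_section (r : M) : X :=
  (sigma (htime tau phi lam r) r, (expR (htime tau phi lam r), 0)).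

Lemma level_sect r : reach tau phi lam r -> psi (stable_section r) = lam.
Proof.
move=> rr; rewrite /cut_moment /= expr0n /= addr0.
exact: (htimeP rr).
Qed.

(* The holomorphic map [(z, r) |-> (tau z r, z)] turns the diagonal action into
   rotation of [z] alone. *)
Definition shear (zr : prod_charted (C1_charted R) M) : X := (act tau zr, zr.1).

Let aCM : atlas (prod_charted (C1_charted R) M) := atlas_prod aC aM.

Lemma mdiff_shear zr : to_C zr.1 != 0 ->
  mdiff shear zr (fun u => (tangent (act tau) zr u, u.1)).
Proof.
move=> zr0; apply: mdiff_pair; first by have [] := act_mdiff holtau zr0.
exact: mdiff_fst.
Qed.

(** Both sides are the velocity at 0 of [t |-> tau (expi t) (sigma s r)], since rotating z rotates
    the image. *)
Lemma shear_gen (s : R) r :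
  let z : C1 R := (expR s, 0) in
  tangent (act tau) (z, r) (cJ z, 0) = cJ (speed (sigma s r)).
Proof.
move=> z; have z0 : to_C z != 0 by exact: to_C_exp_neq0.
have rot0 : of_C (expi 0 * to_C z) = z by rewrite expi0 mul1r.
have z0' : to_C (of_C (expi 0 * to_C z)) != 0 by rewrite rot0.
have := mdiff_act_at mM holtau r z0' (mdiff_rotation z).
rewrite rot0 (_ : (fun t : line R => tau (to_C (of_C (expi t * to_C z))) r : M)
  = fun t : line R => tau (expi t) (sigma s r)); last first.
  apply/funext => t.
  by rewrite -[sigma s r]/(tau (to_C z) r) -(tauM holtau) ?expi_neq0.
have := mdiff_expi_curve mM holtau 0 (sigma s r).
rewrite expi0 (tau1 holtau) => d1 /mdiff_unique/(_ d1)/(congr1 (@^~ 1)) /=.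
by rewrite !scale1r.
Qed.

(** The section is [shear] after [r |-> (e^{s(r)}, r)]. Here [T] is the differential of [htime],
    real-valued; the tangent map of the action is complex linear. *)
Lemma mdiff_sect r : reach tau phi lam r -> exists2 T : Cn R n -> R, linear T &
  let z : C1 R := (expR (htime tau phi lam r), 0) in
  mdiff stable_section r (fun u => (tangent (act tau) (z, r) (T u *: z, u), T u *: z)).
Proof.
move=> rr; have [T dT] := mdiff_htime mM holtau kw ham rr.
exists T; first exact: mdiff_linear dT.
have d1 := mdiff_comp aM aL dT (mdiff_exp (htime tau phi lam r)).
have d2 := mdiff_pair d1 (mdiff_id r aM).
exact: mdiff_comp aM aCM d2 
  (@mdiff_shear ((expR (htime tau phi lam r), 0), r) (to_C_exp_neq0 (htime tau phi lam r))).
Qed.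

(** * The tangent map of the section followed by the projection to the cut *)

Section LocalSection.
Context (Q : charted (Cn R n)) (wQ : form2 Q) (pi : level psi lam -> Q).
Hypothesis cut : kahler_cut w tau wQ pi.
Variable r0 : M.
Hypothesis r0r : reach tau phi lam r0.

Let s0 := htime tau phi lam r0.
Let z0 : C1 R := (expR s0, 0).
Let x0 : X := stable_section r0.
Let G : V := gen x0.
Let D : cprod (C1 R) (Cn R n) -> Cn R n := tangent (act tau) (z0, r0).
(** The tangent map of [shear] at [(z0, r0)]: the complex linear lift with which the section is
    compared. *)
Let B (u : cprod (C1 R) (Cn R n)) : V := (D u, u.1).

Let D_lin : linear D.
Proof. by have [/mdiff_linear] := @act_mdiff _ _ _ _ holtau (z0, r0) (to_C_exp_neq0 s0). Qed.

Let D_J u : D (cJ u) = cJ (D u).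
Proof. by have [_] := @act_mdiff _ _ _ _ holtau (z0, r0) (to_C_exp_neq0 s0); apply. Qed.

Let B_lin : linear B.
Proof. by move=> a u v; rewrite /B D_lin. Qed.

Let B_J u : B (cJ u) = cJ (B u).
Proof. by rewrite /B D_J. Qed.

Let B_gen : B (cJ z0, 0) = G.
Proof. by rewrite /B /D shear_gen. Qed.

Let G_neq0 : G != 0.
Proof.
apply/eqP => /(congr1 (fun u : V => u.2.2)) /= /eqP.
by rewrite gt_eqF// expR_gt0.
Qed.

Let omGJ : 0 < om x0 G (cJ G). Proof. exact: om_pos. Qed.

Let om_linr (c : R) u v t : om x0 t (c *: u + v) = c * om x0 t u + om x0 t v.
Proof. by rewrite (om_anti x0 t) om_linear (om_anti x0 u) (om_anti x0 v); ring. Qed.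

(** The image of C x 0 is spanned over the reals by [G] and [J G]. As om(G, G) = 0 < om(G, J G),
    tangency to the level set kills the [J G] component. *)
Let B_vertical (c : C1 R) : om x0 G (B (c, 0)) = 0 -> exists b, B (c, 0) = b *: G.
Proof.
move=> c0; have e0 : expR s0 != 0 by rewrite gt_eqF// expR_gt0.
have cE : (c, 0 : Cn R n) = (c.2 / expR s0) *: (cJ z0, 0)
    + (- c.1 / expR s0) *: cJ ((cJ z0, 0) : cprod (C1 R) (Cn R n)).
  congr (_, _); last by rewrite /= oppr0 !scaler0 addr0.
  rewrite [LHS]surjective_pairing; congr (_, _) => /=.
    rewrite -[_ *: - 0]/(_ * - 0) -[_ *: - expR s0]/(_ * - expR s0); field => //.
  rewrite -[_ *: - 0]/(_ * - 0) -[_ *: expR s0]/(_ * expR s0); field => //.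
have BE : B (c, 0) = (c.2 / expR s0) *: G + (- c.1 / expR s0) *: cJ G.
  by rewrite cE (linD _ _ B_lin) !(linZ _ _ B_lin) B_J B_gen.
move: c0; rewrite BE om_linr om_self mulr0 add0r -[_ *: cJ G]addr0 om_linr.
rewrite (om_anti _ G 0) om0l oppr0 !addr0 => /eqP.
rewrite mulf_eq0 [X in _ || X]gt_eqF// orbF => /eqP ->.
by exists (c.2 / expR s0); rewrite scale0r addr0.
Qed.

(** A local extension of the projection with its tangent map. Tangency to the level set is written
    [om x0 G u = 0]; [f_om] is what the pullback identity for the reduced form gives on the kernel
    of [df]. *)
Variables (f : X -> Q) (df : V -> Cn R n).
Hypothesis fdf : mdiff f x0 df.
Hypothesis f_surj : forall e, exists2 u, om x0 G u = 0 & df u = e.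
Hypothesis f_J : forall u, om x0 G u = 0 -> om x0 u (cJ G) = 0 -> df (cJ u) = cJ (df u).
Hypothesis f_om : forall u, om x0 G u = 0 -> df u = 0 ->
  forall v, om x0 G v = 0 -> om x0 u v = 0.
Hypothesis f_pi : \forall x \near x0, forall y : level psi lam, val y = x -> f x = pi y.

Let pi_orbit (x y : level psi lam) (t : R) : val y = cut_action tau (expi t) (val x) ->
  pi x = pi y.
Proof.
move=> xy; have [_ _ pE _ _] := cut; apply/pE; exists (expi t) => //.
exact: normc_expi.
Qed.

Let df_lin : linear df := mdiff_linear fdf.

(** The projection, hence [f] near [x0], is constant on the orbit of [x0]. *)
Let df_gen : df G = 0.
Proof.
have d0 := mdiff_orbit x0.
have o0 : cut_action tau (expi 0) x0 = x0 by rewrite expi0 cut_action1.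
have fdf' : mdiff f (cut_action tau (expi 0) x0) df by rewrite o0.
have := mdiff_comp aL aX d0 fdf'.
have lx0 : psi x0 = lam by exact: level_sect.
pose lev x (h : psi x = lam) : level psi lam := exist _ x (mem_set h).
have fcst : \forall t \near (0 : R), f (cut_action tau (expi t) x0) = f x0.
  have co : (fun t : R => cut_action tau (expi t) x0 : X) @ (0 : R)
      --> (cut_action tau (expi 0) x0 : X) by exact: d0.1.
  rewrite o0 in co.
  have {}co : \forall t \near (0 : R), forall y : level psi lam,
    val y = cut_action tau (expi t) x0 -> f (cut_action tau (expi t) x0) = pi y.
    exact: co f_pi.
  apply: filterS co => t ft.
  have lt : psi (cut_action tau (expi t) x0) = lam by rewrite psi_orbit.
  rewrite (ft (lev _ lt) erefl) (nbhs_singleton f_pi (lev _ lx0) erefl).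
  by apply/esym/(@pi_orbit (lev _ lx0) (lev _ lt) t).
move=> d1; have := mdiff_near aL fcst d1.
move=> /mdiff_unique /(_ (mdiff_cst _ _)) /(congr1 (@^~ 1)) /=.
by rewrite scale1r.
Qed.

Lemma section_tangent : exists K,
  [/\ mdiff (f \o stable_section) r0 K, (forall u, K (cJ u) = cJ (K u)),
      injective K & forall e, exists u, K u = e].
Proof.
have [T0 T0_lin dS_] := mdiff_sect r0r.
pose dS u : V := B (T0 u *: z0, u).
have {}dS_ : mdiff stable_section r0 dS by exact: dS_.
have dSl := mdiff_linear dS_.
have lx0 : psi x0 = lam by exact: level_sect.
(* The section stays in the level set, so its tangent vectors do too. *)
have dS0 u : om x0 G (dS u) = 0.
  have ncst : \forall r \near r0, psi (stable_section r) = lam.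
    apply: (@filterS _ (nbhs r0) _ (reach tau phi lam)) => [x|]; first exact: level_sect.
    exact: open_nbhs_nbhs (conj (open_reach lam mM holtau kw ham) r0r).
  have := @mdiff_near _ _ _ M (line R) aM (psi \o stable_section) (fun=> lam) r0 _ ncst
    (mdiff_comp aM aX dS_ (mdiff_psi x0)).
  move=> /mdiff_unique /(_ (mdiff_cst _ _)) /(congr1 (@^~ u)) /= /eqP.
  by rewrite oppr_eq0 => /eqP.
pose K u := df (dS u).
pose be u := - om x0 (dS u) (cJ G) / om x0 G (cJ G).
(* [hl u] is the horizontal vector with the same image as [dS u] in the cut. *)
pose hl u : V := dS u + be u *: G.
have hl_level u : om x0 G (hl u) = 0.
  by rewrite /hl addrC om_linr om_self dS0 mulr0 addr0.
have hl_hor u : om x0 (hl u) (cJ G) = 0.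
  by rewrite /hl /be addrC om_linear -mulrA mulVf ?gt_eqF// mulr1 addNr.
(* Orthogonality to [G] is tangency of [J (hl u)], by J-invariance. *)
have Jhl_level u : om x0 G (cJ (hl u)) = 0.
  have := hl_hor u; rewrite -om_J V_cJK -scaleN1r -[_ *: G]addr0 om_linr.
  rewrite (om_anti _ _ 0) om0l (om_anti _ G) => h; lra.
have df_hl u : df (hl u) = K u.
  by rewrite /hl (linD _ _ df_lin) (linZ _ _ df_lin) df_gen scaler0 addr0.
have vert c : om x0 G (B (c, 0)) = 0 -> df (B (c, 0)) = 0.
  by move=> /B_vertical[b ->]; rewrite (linZ _ _ df_lin) df_gen scaler0.
have hlB u : hl u = B (T0 u *: z0 + be u *: cJ z0, u).
  rewrite /hl -B_gen -(linZ _ _ B_lin) -(linD _ _ B_lin); congr B.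
  by congr (_, _); rewrite /= scaler0 addr0.
have omB u v : om x0 G u = 0 -> om x0 G v = 0 -> om x0 G (u - v) = 0.
  by move=> hu hv; rewrite addrC -scaleN1r om_linr hu hv mulr0 addr0.
have dfB u v : df (u - v) = df u - df v by rewrite (linD _ _ df_lin) (linN _ df_lin).
have [L dL _] := mdiff_tau mM holtau r0 (to_C_exp_neq0 s0).
have DL v : D (0, v) = L v.
  have [da _] := @act_mdiff _ _ _ _ holtau (z0, r0) (to_C_exp_neq0 s0).
  have := mdiff_comp aM aCM (mdiff_pair (mdiff_cst (Y := C1_charted R) r0 z0) (mdiff_id r0 aM)) da.
  by move=> /mdiff_unique /(_ dL) /(congr1 (@^~ v)).
have Klin : linear K by move=> a u v; rewrite /K dSl df_lin.
exists K; split.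
- exact: mdiff_comp aM aX dS_ fdf.
(* The vectors [J (hl u)] and [dS (J u)] are both tangent and differ by the image under [B] of C x
   0, hence by a vertical vector, which [df] kills. *)
- move=> u; rewrite -[in RHS]df_hl -f_J//; apply/eqP; rewrite eq_sym -subr_eq0 -dfB.
  have := omB _ _ (Jhl_level u) (dS0 (cJ u)).
  have -> : cJ (hl u) - dS (cJ u) = 
      B (cJ (T0 u *: z0 + be u *: cJ z0 : C1 R) - T0 (cJ u) *: z0, 0).
    rewrite hlB -B_J /dS -(linN _ B_lin) -(linD _ _ B_lin); congr B.
    by congr (_, _); rewrite /= subrr.
  by move=> /vert ->.
(* Taking [J (hl u)] as test vector in [f_om] gives [hl u = 0] by positivity; its C component then
   vanishes, leaving [D (0, u) = 0]. *)
- have Kinj u : K u = 0 -> u = 0.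
    rewrite -df_hl => /(f_om (hl_level u)) h.
    have hl0 : hl u = 0.
      apply/eqP; apply: contraT => /(om_pos x0).
      by rewrite h// ltxx.
    move: hl0; rewrite hlB; set c := _ + _ => Bc0.
    have c0 : c = 0 by have := congr1 snd Bc0.
    have : D (0, u) = 0 by have := congr1 fst Bc0; rewrite /= c0.
    rewrite (DL u).
    move=> Lu; apply: (tangent_tau_inj mM holtau (to_C_exp_neq0 s0) dL).
    by rewrite Lu (lin0 (mdiff_linear dL)).
  move=> u v uv; apply/eqP; rewrite -subr_eq0; apply/eqP/Kinj.
  by rewrite (linD _ _ Klin) (linN _ Klin) uv subrr.
(* Solve [B (u.2, v) = u] for [v]; then [u - dS v] is tangent and in the image of C x 0, hence
   vertical. *)
- move=> e; have [u u0 <-] := f_surj e.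
  have [v vE] := tangent_tau_surj mM holtau (to_C_exp_neq0 s0) dL (u.1 - D (u.2, 0)).
  exists v; apply/esym/eqP; rewrite -subr_eq0 -dfB.
  have uB : u = B (u.2, v).
    rewrite [LHS]surjective_pairing /B; congr (_, _).
    rewrite (_ : (u.2, v) = (u.2, 0) + (0, v) :> cprod (C1 R) (Cn R n)); last first.
      by congr (_, _); rewrite /= ?addr0 ?add0r.
    by rewrite (linD _ _ D_lin) DL vE addrC subrK.
  have := omB _ _ u0 (dS0 v).
  have -> : u - dS v = B ((u.2 : C1 R) - T0 v *: z0, 0).
    rewrite {1}uB /dS -(linN _ B_lin) -(linD _ _ B_lin); congr B.
    by congr (_, _); rewrite /= subrr.
  by move=> /vert ->.
Qed.

End LocalSection.
End CutGeometry.

(** * The biholomorphism *)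

Section Biholomorphism.
Context (R : realType) (n : nat) (M : charted (Cn R n)).
Context (w : form2 M) (tau : R[i] -> M -> M) (phi : M -> R) (lam : R).
Context (Q : charted (Cn R n)) (wQ : form2 Q).
Context (pi : level (cut_moment phi : MxC M -> R) lam -> Q).
Hypothesis mM : complex_manifold M.
Hypothesis holtau : holomorphic_Cstar_action tau.
Hypothesis kw : kahler_form w.
Hypothesis ham : hamiltonian w tau phi.
Hypothesis cut : kahler_cut w tau wQ pi.

Let aM : atlas M. Proof. by case: mM. Qed.
Let aC : atlas (C1_charted R) := @atlas_C1 R.
Let aX : atlas (MxC M) := atlas_prod aM aC.
Let aQ : atlas Q. Proof. by case: cut => -[[]]. Qed.

Local Notation sigma := (sigma tau).
Local Notation X := (MxC M).
Local Notation psi := (cut_moment phi : X -> R).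
Local Notation sect := (@stable_section _ _ _ tau phi lam).
Local Notation reach := (reach tau phi lam).
Local Notation htime := (htime tau phi lam).
Local Notation S := (M_below phi lam).
Local Notation g := (@cut_map R (Cn R n) M w phi lam).
Local Notation csect := (@cut_section R (Cn R n) M phi lam).

Definition embed (q : S) : Q := pi (csect q).
Local Notation j := embed.

(** [H] is a local formula for [r |-> [sect r]], that is for the inverse of g seen in Q, built from
    a local extension of [pi]. *)
Lemma local_section r0 : reach r0 -> exists (H : M -> Q) K,
  [/\ mdiff H r0 K, (forall u, K (cJ u) = cJ (K u)), injective K,
      forall e, exists u, K u = e &
      \forall r \near r0, forall y : level psi lam, val y = sect r -> H r = pi y].
Proof.
move=> r0r; have lx0 : psi (sect r0) = lam by exact: level_sect.
pose x0 : level psi lam := exist _ (sect r0) (mem_set lx0).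
have [[_ kQ] _ _ _ /(_ x0)] := cut.
move=> [f [U [[oU Ux0] [sf fE] fs fJ fo]]].
have genE : generator (cut_action tau : R[i] -> X -> X) (sect r0) = gen tau (sect r0).
  exact: generator_cut.
have levE u : level_tangent psi (sect r0) u <-> cut_form w (sect r0) (gen tau (sect r0)) u = 0.
  rewrite /level_tangent /= (differential_psi mM holtau ham).
  by split=> [/eqP|->]; rewrite ?oppr0// oppr_eq0 => /eqP.
have fx0 : mdiff f (sect r0) (tangent f (sect r0)).
  split; first by apply: sf.1; exact: Ux0.
  apply: DiffDef => //.
  have [+ _] := sf.2 (sect r0) (f (sect r0)) 1%N; apply.
  exists (sect r0) => //; split; last exact: dom_center.
  by split; [exact: dom_center|exact: Ux0].
have fpi : \forall x \near sect r0, forall y : level psi lam, val y = x -> f x = pi y.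
  have : \forall x \near sect r0, U x by exact: open_nbhs_nbhs.
  by apply: filterS => x xU y yx; rewrite -yx fE// yx.
have [||||K [dK KJ Ki Ks]] := section_tangent mM holtau kw ham cut r0r fx0.
- by move=> e; have [u /levE] := fs e; exists u.
- move=> u /levE u0 uJ; apply: fJ; split => //.
  by rewrite genE.
- move=> u /levE u0 fu0 v /levE v0.
  have := fo u v u0 v0; rewrite fu0 => <-.
  have [[wl wN] _ _ _ _] := kQ.
  by rewrite wN; have := wl (pi x0) 1 (tangent f (sect r0) v) 0 0; rewrite scale1r addr0; lra.
- exact: fpi.
exists (f \o sect), K; split=> //.
have [T _ dL] := mdiff_sect mM holtau kw ham r0r.
exact: dL.1 fpi.
Qed.

Lemma below_lt (q : S) : phi (val q) < lam.
Proof. exact: (set_mem (valP q)). Qed.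

Lemma expR_kappa (q : S) : expR (- kappa phi lam (val q)) = Num.sqrt (lam - phi (val q)).
Proof.
have d0 : 0 < lam - phi (val q) by rewrite subr_gt0 below_lt.
have e2 : expR (- kappa phi lam (val q)) ^+ 2 = lam - phi (val q).
  by rewrite -expRM_natl /kappa mulNr opprK mulrA divff ?pnatr_eq0// mul1r lnK.
by rewrite -e2 sqrtr_sqr ger0_norm// expR_ge0.
Qed.

Lemma cut_mapE (q : S) : g q = sigma (kappa phi lam (val q)) (val q).
Proof.
by rewrite /cut_map (gradient_speed mM holtau kw ham) (exp_speed mM holtau).
Qed.

Lemma height_cut_map (q : S) : height tau phi (g q) (- kappa phi lam (val q)) = lam.
Proof.
rewrite /height cut_mapE (sigmaK holtau) expR_kappa sqr_sqrtr ?subr_ge0 1?ltW ?below_lt//.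
by rewrite addrC subrK.
Qed.

Lemma reach_cut_map (q : S) : reach (g q).
Proof. by eexists; exact: height_cut_map. Qed.

(** The link between g and the section: the class of [sect (g q)] is [embed q]. Injectivity of g
    follows as well. *)
Lemma sect_cut_map (q : S) : sect (g q) = val (csect q).
Proof.
rewrite /stable_section (htime_eq mM holtau kw ham (height_cut_map q)) expR_kappa.
by rewrite cut_mapE (sigmaK holtau).
Qed.

Lemma cut_map_inj : injective g.
Proof.
move=> q1 q2 g12; apply: val_inj.
by have := sect_cut_map q1; rewrite g12 sect_cut_map => /(congr1 fst).
Qed.

Lemma cut_map_surj r : reach r -> exists q : S, g q = r.
Proof.
move=> rr; have := htimeP rr; rewrite /height => hr.
have lt : phi (sigma (htime r) r) < lam by rewrite -[X in _ < X]hr ltrDl exprn_gt0// expR_gt0.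
exists (exist (fun x => x \in S) _ (mem_set lt)).
rewrite cut_mapE /= /kappa -[X in ln (X - _)]hr addrC addKr -expRM_natl expRK.
by rewrite mulNr mulrA mulVf ?mul1r ?(sigmaK holtau)// pnatr_eq0.
Qed.

(** A rotation between two points whose C coordinates are positive reals is trivial. *)
Lemma embed_inj : injective j.
Proof.
move=> q1 q2 /=; have [_ _ pE _ _] := cut => /pE[a /normc1_expi[t <-]].
have [d1 d2] : 0 < Num.sqrt (lam - phi (val q1)) /\ 0 < Num.sqrt (lam - phi (val q2)).
  by rewrite !sqrtr_gt0 !subr_gt0 !below_lt.
rewrite /= /cut_action /= => -[q12].
rewrite !mulr0 subr0 add0r => h1 h2.
have st : sin t = 0.
  by move/esym/eqP: h2; rewrite mulf_eq0 [X in _ || X]gt_eqF// orbF => /eqP.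
have ct : cos t = 1.
  have ct0 : 0 < cos t by rewrite -(pmulr_lgt0 _ d1) -h1.
  have := cos2Dsin2 t; rewrite st expr0n /= addr0 => /eqP; rewrite sqrf_eq1.
  by case/orP => /eqP // ctN; move: ct0; rewrite ctN ltr0N1.
by apply/esym/val_inj; rewrite /= q12 /expi ct st (tau1 holtau).
Qed.

(** * Continuity and holomorphy of g and its inverse *)

Lemma sqr_norm_continuous : continuous (fun z : R * R => z.1 ^+ 2 + z.2 ^+ 2).
Proof.
move=> z; apply: (@continuousD _ _ _ (fun z : R * R => z.1 ^+ 2) (fun z : R * R => z.2 ^+ 2)).
  apply: (@continuous_comp _ _ _ (@fst R R) (fun a : R => a ^+ 2)); first exact: cvg_fst.
  exact: exprn_continuous.
apply: (@continuous_comp _ _ _ (@snd R R) (fun a : R => a ^+ 2)); first exact: cvg_snd.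
exact: exprn_continuous.
Qed.

Lemma to_C_neq0 (z : R * R) : (to_C z != 0) = (0 < z.1 ^+ 2 + z.2 ^+ 2).
Proof.
by rewrite eq_complex /= lt_def addr_ge0 ?sqr_ge0// andbT paddr_eq0 ?sqr_ge0// !sqrf_eq0.
Qed.

Lemma inv_continuous (z : R * R) : 0 < z.1 ^+ 2 + z.2 ^+ 2 ->
  {for z, continuous (fun y : R * R => of_C (to_C y)^-1)}.
Proof.
move=> z0; have zn0 : z.1 ^+ 2 + z.2 ^+ 2 != 0 by rewrite gt_eqF.
have cV : {for z, continuous (fun y : R * R => (y.1 ^+ 2 + y.2 ^+ 2)^-1)}.
  by apply: continuousV => //; exact: sqr_norm_continuous.
suff : {for z, continuous (fun y : R * R =>
    (y.1 / (y.1 ^+ 2 + y.2 ^+ 2), - (y.2 / (y.1 ^+ 2 + y.2 ^+ 2))))} by [].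
apply: (@cvg_pair _ _ _ (nbhs z) (nbhs (z.1 / (z.1 ^+ 2 + z.2 ^+ 2)))
   (nbhs (- (z.2 / (z.1 ^+ 2 + z.2 ^+ 2))))).
  by apply: (@continuousM _ _ (@fst R R)) => //; exact: cvg_fst.
apply: (@continuousN _ _ _ (fun y : R * R => y.2 / (y.1 ^+ 2 + y.2 ^+ 2))).
by apply: (@continuousM _ _ (@snd R R)) => //; exact: cvg_snd.
Qed.

(** This is continuity of g for the quotient topology, tested on the level set; [A = setT] also
    shows that the image of [embed] is open. *)
Lemma open_embed_image (A : set M) : open A -> open [set y | exists2 q : S, j q = y & A (g q)].
Proof.
move=> oA; have [_ _ pE oE _] := cut; apply/oE.
have tauV x (s t : R) : tau (to_C (expR s, 0) * expi t)^-1 x = sigma (- s) (tau (expi (- t)) x).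
  rewrite -[RHS](tauM holtau) ?expi_neq0 ?to_C_exp_neq0//; apply: (congr1 (tau ^~ x)).
  apply: (mulIf (x := to_C (expR s, 0) * expi t)).
    by rewrite mulf_neq0 ?expi_neq0 ?to_C_exp_neq0.
  rewrite mulVf ?mulf_neq0 ?expi_neq0 ?to_C_exp_neq0//.
  rewrite mulrACA -expiD addNr expi0 mulr1; apply/eqP; rewrite eq_complex /=.
  by rewrite !mul0r !mulr0 subr0 addr0 -expRD addNr expR0 !eqxx.
(* On this set [cut_map] of the class of [x] is [tau (1 / x.2) x.1]. *)
exists [set x : X | 0 < x.2.1 ^+ 2 + x.2.2 ^+ 2 /\ A (tau (to_C x.2)^-1 x.1)].
  rewrite openE => x [x2 Ax].
  have c2 : {for x, continuous (fun x : X => x.2.1 ^+ 2 + x.2.2 ^+ 2)}.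
    apply: (@continuous_comp _ _ _ (fun x : X => (x.2 : R * R))
      (fun z : R * R => z.1 ^+ 2 + z.2 ^+ 2)); first exact: cvg_snd.
    exact: sqr_norm_continuous.
  have n2 : \forall y \near x, 0 < y.2.1 ^+ 2 + y.2.2 ^+ 2.
    exact: (c2 _ (lt_nbhsr x2)).
  have ci : {for x, continuous (fun x : X => 
      (of_C (to_C x.2)^-1, x.1) : prod_charted (C1_charted R) M)}.
    apply: (@cvg_pair _ _ _ (nbhs x) (nbhs (of_C (to_C x.2)^-1)) (nbhs x.1)); last exact: cvg_fst.
    apply: (@continuous_comp _ _ _ (fun x : X => (x.2 : R * R))
      (fun z : R * R => of_C (to_C z)^-1)); first exact: cvg_snd.
    exact: inv_continuous.
  have i0 : to_C (of_C (to_C x.2)^-1) != 0.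
    rewrite (_ : to_C _ = (to_C x.2)^-1) ?invr_eq0 ?to_C_neq0//.
  have [[ca _] _] := @act_mdiff _ _ _ _ holtau (of_C (to_C x.2)^-1, x.1) i0.
  have cact := continuous_comp ci ca.
  have nA : \forall y \near x, A (tau (to_C y.2)^-1 y.1).
    apply: cact; apply: open_nbhs_nbhs; split; first exact: oA.
    exact: Ax.
  by apply: filterS2 n2 nA.
move=> x; have xlam : psi (val x) = lam by exact: (set_mem (valP x)).
split=> [[q /pE[a /normc1_expi[t <-]] xE Agq]|[x2 Ax]].
  have zE : to_C (val x).2 = to_C (expR (- kappa phi lam (val q)), 0) * expi t.
    rewrite xE expR_kappa mulrC.
    by apply/eqP; rewrite eq_complex /= !eqxx.
  split; first by rewrite /= -to_C_neq0 zE mulf_neq0 ?expi_neq0 ?to_C_exp_neq0.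
  rewrite zE tauV opprK xE /= -(tauM holtau) ?expi_neq0// -expiD addNr expi0.
  by rewrite (tau1 holtau) -cut_mapE.
have z0 : to_C (val x).2 != 0 by rewrite to_C_neq0.
have [s [t zE]] := polar z0.
(* Rotating [x] by [expi (- t)] makes its C coordinate the positive real e^s, so the rotated point
   is in the section, over a point with [kappa] equal to [- s]. *)
have pE' : phi (tau (expi (- t)) (val x).1) = lam - expR s ^+ 2.
  rewrite (phi_expi mM holtau kw ham).
  have [xa xb] : (val x).2.1 = expR s * cos t /\ (val x).2.2 = expR s * sin t.
    split; first by have := congr1 (@complex.Re R) zE; rewrite /= mul0r subr0.
    by have := congr1 (@complex.Im R) zE; rewrite /= mul0r addr0.
  move: xlam; rewrite /cut_moment xa xb !exprMn -mulrDr cos2Dsin2 mulr1 => xl; lra.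
have ltq : phi (tau (expi (- t)) (val x).1) < lam.
  by rewrite pE' ltrBlDr ltrDl exprn_gt0// expR_gt0.
pose q : S := exist (fun x => x \in S) _ (mem_set ltq).
have kE : kappa phi lam (val q) = - s.
  rewrite /kappa /= pE' opprB addrC subrK -expRM_natl expRK.
  by rewrite mulNr mulrA mulVf ?mul1r// pnatr_eq0.
exists q; last by rewrite cut_mapE kE /= -tauV -zE.
apply/pE; exists (expi t); first exact: normc_expi.
rewrite [LHS]surjective_pairing /cut_action /= -(tauM holtau) ?expi_neq0//.
rewrite -expiD subrr expi0 (tau1 holtau).
have sE := expR_kappa q; rewrite kE opprK /= in sE; rewrite -sE.
congr (_, _).
rewrite [LHS](_ : _ = of_C (to_C (val x).2)); last by case: (val x).2.
by rewrite zE mulrC.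
Qed.

(* [q0] is only a default value, for [y] outside the image of [embed]. *)
Definition coembed (y : Q) (q0 : S) : M := g (xget q0 [set q | j q = y]).

Lemma coembedE q0 q : coembed (j q) q0 = g q.
Proof. by rewrite /coembed; case: xgetP => [q' _ /embed_inj -> //|/(_ q) []]. Qed.

Lemma coembed_continuous q0 q : {for j q, continuous (coembed^~ q0)}.
Proof.
move=> A; rewrite /continuous_at (coembedE q0 q) nbhsE => -[B [oB Bq] BA].
have oj := open_embed_image oB.
have : \forall y \near j q, [set y | exists2 q : S, j q = y & B (g q)] y.
  by apply: open_nbhs_nbhs; split=> //; exists q.
by apply: filterS => _ [q' <- Bq']; apply: BA; rewrite /= coembedE.
Qed.

Lemma near_embed q : \forall y \near j q, exists q', j q' = y.
Proof.
have : \forall y \near j q, [set y | exists2 q : S, j q = y & setT (g q)] y.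
  apply: open_nbhs_nbhs; split; last by exists q.
  exact: (open_embed_image openT).
by apply: filterS => y [q' <- _]; exists q'.
Qed.

Lemma coembed_holomorphic q0 q : exists2 A, mdiff (coembed^~ q0) (j q) A &
  forall u, A (cJ u) = cJ (A u).
Proof.
have [H [K [dH KJ Ki Ks Hpi]]] := local_section (reach_cut_map q).
have Hj q' : val (csect q') = sect (g q') by rewrite sect_cut_map.
have Hq : H (g q) = j q by exact: nbhs_singleton Hpi _ (Hj q).
have Gq := coembedE q0 q.
(* [A] is the inverse of [K]: injectivity makes it two-sided and linear, finite dimension
   continuous. *)
have [A AK] : exists A, forall e, K (A e) = e.
  by exists (fun e => xget 0 [set u | K u = e]) => e; case: xgetP => //;
    have [u ue] := Ks e => /(_ u) [].
have Klin := mdiff_linear dH.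
have KA u : A (K u) = u by apply: Ki; rewrite AK.
have Alin : linear A by move=> a u v; apply: Ki; rewrite Klin !AK.
have Acont : continuous A by exact: Cn_linear_continuous.
exists A; last by move=> u; apply: Ki; rewrite KJ !AK.
have cc := @coembed_continuous q0 q.
split; first exact: cc.
pose Ht := in_charts H (g q) (j q).
pose y := in_charts (coembed^~ q0) (j q) (g q).
have rr0 := dom_center aM (g q).
have yy0 := dom_center aQ (j q).
have y0 : y (chart (j q) (j q)) = chart (g q) (g q).
  by rewrite /y /in_charts /= (param_chart aQ yy0) Gq.
have dHt : is_diff (chart (g q) (g q)) Ht K by have := dH.2; rewrite Hq.
(* The equation Ht(y(u)) = u, which says that [y] inverts [Ht], put in the form of
   [implicit_is_diff]. *)
have dPhi : is_diff (chart (j q) (j q), y (chart (j q) (j q)))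
    (fun p : Cn R n * Cn R n => Ht p.2 - p.1) (fun p => K p.2 - p.1).
  rewrite y0.
  have d1 : is_diff (chart (j q) (j q), chart (g q) (g q)) (@fst (Cn R n) (Cn R n)) fst.
    by apply: is_diff_lin => // u; exact: cvg_fst.
  have d2 : is_diff (chart (j q) (j q), chart (g q) (g q)) (@snd (Cn R n) (Cn R n)) snd.
    by apply: is_diff_lin => // u; exact: cvg_snd.
  have d3 := is_diff_comp (f := snd) d2 dHt.
  exact: is_diffB d3 d1.
rewrite Gq.
have : is_diff (chart (j q) (j q)) y (fun h => - A (K 0 - h)).
  apply: (implicit_is_diff dPhi _ _ Alin Acont).
  - rewrite /y; apply: (@continuous_comp _ _ _ (fun u => coembed (param (j q) u) q0) (chart (g q))).
      apply: (@continuous_comp _ _ _ (param (j q)) (coembed^~ q0)).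
        exact: param_continuous.
      exact: (eq_ind_r (fun z => {for z, continuous (coembed^~ q0)}) cc (param_chart aQ yy0)).
    apply: chart_continuous => //.
    by rewrite (param_chart aQ yy0) Gq.
  (* The equation holds near the centre: there [param (j q) u] is in the image of [embed], on which
     [H] undoes [coembed]. *)
  - have nG (P : set M) : (\forall r \near g q, P r) ->
        \forall u \near chart (j q) (j q), P (coembed (param (j q) u) q0).
      move=> gP; apply: (near_param aQ yy0 (P := fun y => P (coembed y q0))).
      have cc' : coembed^~ q0 @ j q --> coembed (j q) q0 by exact: cc.
      by rewrite Gq in cc'; exact: cc' gP.
    have nd := nG _ (near_dom aM (g q)).
    have nH := nG _ Hpi.
    have ne := near_param aQ yy0 (near_embed q).
    have nc := chart_param aQ yy0.
    near=> u.
    have ud : dom (g q) (coembed (param (j q) u) q0) by near: u.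
    have [q' q'E] : exists q', j q' = param (j q) u by near: u.
    have uH : forall y : level psi lam, val y = sect (coembed (param (j q) u) q0) ->
      H (coembed (param (j q) u) q0) = pi y by near: u.
    have [_ uE] : dom (j q) (param (j q) u) /\ chart (j q) (param (j q) u) = u by near: u.
    have Hu : H (coembed (param (j q) u) q0) = param (j q) u.
      by rewrite (uH (csect q')) -q'E// coembedE Hj.
    have Eu : Ht (y u) = u.
      by rewrite /Ht /y /in_charts /= (param_chart aM ud) Hu uE.
    have E0 : Ht (y (chart (j q) (j q))) = chart (j q) (j q).
      by rewrite y0 /Ht /in_charts /= (param_chart aM rr0) Hq.
    by rewrite /= Eu E0 !subrr.
  - by move=> k /=; rewrite subr0 KA.
congr is_diff_def; apply/funext => u.
by rewrite lin0// sub0r (linN _ Alin) opprK.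
Unshelve. all: by end_near. Qed.

Lemma embed_continuous : continuous (j : M_below_cut pi -> Q).
Proof. exact: initial_continuous. Qed.

Lemma cut_map_holomorphic :
  holomorphic_on (g : M_below_cut pi -> M) [set: M_below_cut pi].
Proof.
(* With default [q], the choice in [coembed] is the one in [param] of the transported charts, so the
   two coordinate expressions are convertible. *)
move=> q _; have [A [cG dG] AJ] := coembed_holomorphic q q.
have Gq := coembedE q q; split.
  have -> : (g : M_below_cut pi -> M) = (fun y => coembed y q) \o (j : M_below_cut pi -> Q).
    by apply/funext => q'; rewrite /= coembedE.
  by apply: continuous_comp; [exact: embed_continuous|exact: cG].
have {}dG : is_diff (chart q q) (in_charts (g : M_below_cut pi -> M) q (g q)) A.
  by rewrite Gq in dG; exact: dG.
have [dg dgE] := dG.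
by split=> [//|u]; rewrite dgE AJ.
Qed.

(** Near a point of [reach], [j \o h] is the map [H] of [local_section], and the transported charts
    read [h] through [j]. *)
Lemma inverse_holomorphic (h : M -> M_below_cut pi) : cancel g h -> holomorphic_on h reach.
Proof.
move=> gh r rr; have [H [K [dH KJ _ _ Hpi]]] := local_section rr.
have near_r : \forall r' \near r, H r' = j (h r').
  have rn : \forall r' \near r, reach r'.
    exact: open_nbhs_nbhs (conj (open_reach lam mM holtau kw ham) rr).
  apply: filterS2 Hpi rn => r' Hr' /cut_map_surj[q qE].
  by rewrite (Hr' (csect q)) -?sect_cut_map ?qE// -qE gh.
have [cjh [djh djhE]] : mdiff (j \o h) r K := mdiff_near aM near_r dH.
split.
  (* Open sets of the transported topology are preimages under [embed], so continuity of [j \o h]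
     suffices. *)
  move=> A; rewrite /= nbhsE => -[B [[C oC CB] Bh] BA].
  have : \forall r' \near r, C (j (h r')).
    apply: cjh; apply: open_nbhs_nbhs; split=> //.
    by move: Bh; rewrite -CB.
  by apply: filterS => r' Cr'; apply: BA; rewrite -CB.
split; first exact: djh.
by move=> u; rewrite [LHS](congr1 (@^~ (cJ u)) djhE) KJ -djhE.
Qed.

End Biholomorphism.

Theorem theorem2p1 (R : realType) (n : nat) (M : charted (Cn R n))
    (w : form2 M) (tau : R[i] -> M -> M) (phi : M -> R) (lam : R)
    (Q : charted (Cn R n)) (wQ : form2 Q)
    (pi : level (@cut_moment R (Cn R n) M phi) lam -> Q) :
  complex_manifold M ->
  kahler_form w ->
  hamiltonian w tau phi ->
  holomorphic_Cstar_action tau ->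
  free_on tau [set p | phi p = lam] ->
  kahler_cut w tau wQ pi ->
  biholomorphism_onto
    (@cut_map R (Cn R n) M w phi lam : M_below_cut pi -> M) (M_sharp tau phi lam).
Proof.
move=> mM kw ham holtau free cut.
rewrite (M_sharpE mM holtau kw ham free); split.
- exact: open_reach mM holtau kw ham.
- split=> [q _|q1 q2 _ _|r /(cut_map_surj mM holtau kw ham)[q qE]].
  + exact: (reach_cut_map mM holtau kw ham).
  + exact: (cut_map_inj mM holtau kw ham).
  + by exists q.
- exact: (cut_map_holomorphic mM holtau kw ham cut).
- by move=> h; exact: (inverse_holomorphic mM holtau kw ham cut).
Qed.
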